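(* Let $(\mu_n)_{n\in\mathbb{N}}$ be a martingale measure on $\mathbb{R}^M$ and let $\{\eta_t\}_{t\in\Gamma}$ be a family of measures on $\mathbb{R}^M$ indexed by a totally bounded metric space $(\Gamma,d)$, such that $(\mu_n)$ is weakly spatially dependent with parameter $\delta\ge0$ with respect to $\{\eta_t\}_{t\in\Gamma}$. Assume that there are positive constants $\alpha,\kappa,\theta,\gamma_0$ such that the following holds: (H1) $\Gamma$ has finite upper box-counting dimension, i.e. it can be covered by $O(1)r^{-O(1)}$ balls of radius $r$ for all $r\in(0,1]$. (H2) The family $\{\eta_t\}_{t\in\Gamma}$ has Frostman exponent $\kappa$. (H3) Almost surely, $\mu_n(x)\le 2^{\alpha n}$ for all $n\in\mathbb{N}$ and $x\in\mathbb{R}^M$. (H4) Almost surely, there is a (random) integer $K$ such that \[ \sup_{t,u\in\Gamma,\,t\ne u;\ n\ge K}\frac{|Y_n^t-Y_n^u|}{2^{\theta n}\,d(t,u)^{\gamma_0}}<\infty . \] Further, suppose that $\kappa-\alpha-\delta>0$. Then there is a deterministic number $\gamma>0$ (depending on all parameters) such that almost surely $Y_n^t$ converges uniformly in $t\in\Gamma$, exponentially fast, to a limit $Y^t$, and the function $t\mapsto Y^t$ is Hölder continuous with exponent $\gamma$.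
   Context: Random measures. $(\mu_n)_{n\ge0}$ is a sequence of random Borel functions $\mu_n:\mathbb{R}^M\to[0,+\infty)$ (identified with the absolutely continuous measures with these densities) such that: (RM1) $\mu_0$ is a deterministic bounded function with bounded support; (RM2) there is an increasing filtration of $\sigma$-algebras $\mathcal{B}_n$ such that $\mu_n$ is $\mathcal{B}_n$-measurable; (RM3) there is $C<\infty$ such that $\mu_{n+1}(x)\le C\mu_n(x)$ for all $n$ and $x$. It is a martingale measure if in addition $\mathbb{E}(\mu_{n+1}(x)\mid\mathcal{B}_n)=\mu_n(x)$ for all $x\in\mathbb{R}^M$, $n\in\mathbb{N}$. Intersections. For a family $\{\eta_t\}_{t\in\Gamma}$ of deterministic (locally finite Borel) measures, $\mu_n^t(B)=\int_B\mu_n\,d\eta_t$ for Borel $B$, and $Y_n^t=\mu_n^t(\mathbb{R}^M)=\int\mu_n\,d\eta_t$; $Y^t=\lim_nY_n^t$ if it exists. Frostman exponent. $\{\eta_t\}_{t\in\Gamma}$ has Frostman exponent $\kappa\ge0$ if there is $C>0$ such that $\eta_t(B(x,r))\le Cr^\kappa$ for all $t\in\Gamma$, $x\in\mathbb{R}^M$, $0<r<1$. Dependency. A graph with vertex set $I$ is a dependency graph for random variables $\{X_i\}_{i\in I}$ if whenever $i\in I$ and $J\subset I$ are such that there is no edge from $i$ to any element of $J$, $X_i$ is independent of $\{X_j\}_{j\in J}$. Let $\mathcal{Q}_{n}$ be the half-open dyadic cubes of $\mathbb{R}^M$ of side-length $2^{-n}$. The dependency degree $\mathcal{DI}_n$ is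 the smallest $\Psi$ such that for all $t\in\Gamma$ there is a dependency graph for $\{\mu_{n+1}^t(Q)\}_{Q\in\mathcal{Q}_{n+1}}$, conditional on $\mathcal{B}_n$, of (maximal) degree at most $\Psi$. Weak spatial dependence. For a positive probability event $\mathfrak{C}$ write $\mathbb{P}_{\mathfrak{C}}=\mathbb{P}(\cdot\mid\mathfrak{C})$. A sequence $(\mu_n)$ satisfying (RM1)--(RM3) is weakly spatially dependent with parameter $\delta\ge0$ (w.r.t. $\{\eta_t\}$) if there is a random sequence $\Psi(n)$ such that: (1) $\mathcal{DI}_n\le\Psi(n)$ for all $n$; (2) for each $\varepsilon>0$ there exist a deterministic $C=C_\varepsilon>0$, numbers $\varepsilon_n>0$ with $\sum_n\varepsilon_n<\varepsilon$, and $\mathcal{B}_n$-measurable events $\mathfrak{C}_n\subset\{\Psi(n)\le C2^{\delta n}\}$ such that $\mathbb{P}_{\mathfrak{C}_{n-1}}(\mathfrak{C}_n\mid\mathcal{B}_{n-1})\ge1-\varepsilon_n$ for $n\ge1$, where for $n=1$ one uses $\mathfrak{C}_0=\Omega$ (the entire probability space). (The bound is required for every realization of $\mathcal{B}_{n-1}$ in $\mathfrak{C}_{n-1}$.) *)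

(* Defs.v *)
From HB Require Import structures.
From mathcomp Require Import all_boot all_order all_algebra.
From mathcomp Require Import all_classical all_reals all_analysis.
Set Implicit Arguments.
Unset Strict Implicit.
Unset Printing Implicit Defensive.
Import Order.TTheory GRing.Theory Num.Theory.
Import numFieldNormedType.Exports.
Local Open Scope classical_set_scope.
Local Open Scope ring_scope.

(* R^M with its Borel sigma-algebra.  The sup norm and the Euclidean norm give
   the same topology, hence the same Borel sets. *)
Notation borelRn R M := (g_sigma_algebraType (@open 'rV[R]_M)).

Section euclidean.
Context {R : realType} {M : nat}.

(* The library norm on 'rV[R]_M is the sup norm. *)
Definition euclidean_dist (x y : 'rV[R]_M) : R :=
  Num.sqrt (\sum_(i < M) (x ord0 i - y ord0 i) ^+ 2).

Definition euclidean_ball (x : 'rV[R]_M) (r : R) : set 'rV[R]_M :=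
  [set y | euclidean_dist x y <= r].

(* Half-open dyadic cubes of side 2^-n, indexed by integer vectors; for fixed n
   the indexing is injective. *)
Definition dyadic_cube (n : nat) (k : 'rV[int]_M) : set 'rV[R]_M :=
  [set x | forall i, (k ord0 i)%:~R / 2 ^+ n <= x ord0 i
                     < (k ord0 i + 1)%:~R / 2 ^+ n].

End euclidean.

Section conditioning.
Context d {Omega : measurableType d} {R : realType}.
Implicit Types (P : probability Omega R) (G : set (set Omega)).

(* Z is a version of E(X | G), for a sub-sigma-algebra G. *)
Definition is_cond_expectation P G (X Z : Omega -> R) : Prop :=
  [/\ P.-integrable setT (EFin \o X),
      P.-integrable setT (EFin \o Z),
      measurable_fun [set: g_sigma_algebraType G] Z &
      forall A, G A ->
        (\int[P]_(w in A) (Z w)%:E = \int[P]_(w in A) (X w)%:E)%E].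

Definition is_cond_probability P G (E : set Omega) (Z : Omega -> R) : Prop :=
  is_cond_expectation P G (\1_E) Z.

(* P( . | C): U |-> P (U `&` C) / P C when P C > 0. *)
Definition cond_proba P (C : set Omega) (mC : measurable C) :
    probability Omega R :=
  mnormalize (mrestr P mC) P.

(* Conditionally on G, the families U and V of events are independent for
   almost every realization in A. *)
Definition cond_independent_on P G (A : set Omega) (U V : set (set Omega)) :=
  forall E F, U E -> V F -> exists ZE ZF ZEF : Omega -> R,
    [/\ is_cond_probability P G E ZE,
        is_cond_probability P G F ZF,
        is_cond_probability P G (E `&` F) ZEF &
        {ae P, forall w, A w -> ZEF w = ZE w * ZF w}].

(* Generated sigma-algebra of the family (X j), j in J. *)
Definition sigma_family (I : Type) (X : I -> Omega -> R) (J : set I) :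
    set (set Omega) :=
  <<s \bigcup_(j in J) preimage_set_system setT (X j) measurable >>.

Definition simple_graph (I : Type) (E : I -> I -> Prop) : Prop :=
  (forall i j, E i j -> E j i) /\ (forall i, ~ E i i).

Definition max_degree_le (I : Type) (E : I -> I -> Prop) (k : nat) : Prop :=
  forall i, ([set j | E i j] #<= `I_k)%card.

(* Dependency graph for (X i), conditional on G: a graph depending on the
   realization of G, i.e. a G-measurable random graph.  Since the graph has no
   loops, the sets J are taken not to contain i (otherwise i \in J would force
   X i to be independent of itself). *)
Definition cond_dependency_graph P G (I : Type) (X : I -> Omega -> R)
    (E : Omega -> I -> I -> Prop) : Prop :=
  [/\ forall w, simple_graph (E w),
      forall i j, G [set w | E w i j] &
      forall (i : I) (J : set I), ~ J i ->
        cond_independent_on P G [set w | forall j, J j -> ~ E w i j]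
          (sigma_family X [set i]) (sigma_family X J)].

Definition filtration (B : nat -> set (set Omega)) : Prop :=
  [/\ forall n, sigma_algebra setT (B n),
      forall n, B n `<=` measurable &
      forall n, B n `<=` B n.+1].

End conditioning.

Section random_measures.
Context d {Omega : measurableType d} {R : realType} {M : nat}.
Variables (P : probability Omega R) (B : nat -> set (set Omega)).
Variable mu : nat -> Omega -> 'rV[R]_M -> R.

(* Conditions (RM1)-(RM3).  "mu_n is a random Borel function, B_n-measurable"
   is joint measurability of (w, x) |-> mu_n(w)(x) with respect to the product
   of B_n and the Borel sets; it makes every realization mu n w Borel. *)
Record random_measures : Prop := {
  rm_ge0 : forall n w x, 0 <= mu n w x;
  rm1 : exists f : 'rV[R]_M -> R,
    [/\ forall w, mu 0%N w = f,
        exists c : R, forall x, f x <= c &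
        bounded_set [set x | f x != 0]];
  rm2_filtration : filtration B;
  rm2 : forall n,
    measurable_fun [set: g_sigma_algebraType (B n) * borelRn R M]
      (fun wx => mu n wx.1 wx.2);
  rm3 : exists C : R, forall n w x, mu n.+1 w x <= C * mu n w x }.

Definition martingale_measure : Prop :=
  random_measures /\
  forall n x, is_cond_expectation P (B n) (fun w => mu n.+1 w x)
                                  (fun w => mu n w x).

Context {Gamma : Type}.
Variable eta : Gamma -> {measure set (borelRn R M) -> \bar R}.

Definition locally_finite_family : Prop :=
  forall t (x : 'rV[R]_M), exists U : set 'rV[R]_M,
    [/\ open U, U x & (eta t U < +oo)%E].

(* mu_n^t(A), and Y_n^t = mu_n^t(R^M).  These integrals are finite under
   (RM1), (RM3) and local finiteness. *)
Definition intersection_mass (n : nat) (t : Gamma) (A : set 'rV[R]_M)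
    (w : Omega) : R :=
  \int[eta t]_(x in (A : set (borelRn R M))) mu n w x.

Definition total_mass (n : nat) (t : Gamma) (w : Omega) : R :=
  intersection_mass n t setT w.

Definition limit_mass (t : Gamma) (w : Omega) : R :=
  limn (fun n => total_mass n t w).

(* DI_n <= Psi.  The dependency degree, being defined conditionally on B_n, is a
   random variable, and so is the bound Psi. *)
Definition dependency_degree_le (n : nat) (Psi : Omega -> nat) : Prop :=
  forall t : Gamma, exists E : Omega -> 'rV[int]_M -> 'rV[int]_M -> Prop,
    cond_dependency_graph P (B n)
      (fun k => intersection_mass n.+1 t (dyadic_cube n.+1 k)) E /\
    {ae P, forall w, max_degree_le (E w) (Psi w)}.

(* The events are indexed from 1; Ev 0 is the whole space, and no bound on
   Psi 0 is required.  The conditional probability is bounded for every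
   realization in Ev n, for some version of it. *)
Definition weakly_spatially_dependent (delta : R) : Prop :=
  exists Psi : nat -> Omega -> nat,
  [/\ forall n, measurable_fun setT (Psi n),
      forall n, dependency_degree_le n (Psi n) &
      forall eps : R, 0 < eps ->
      exists (C : R) (eps_ : nat -> R) (Ev : nat -> set Omega)
             (mEv : forall n, measurable (Ev n)),
      [/\ 0 < C,
          (forall n, 0 < eps_ n) /\
            (\sum_(1 <= n <oo) (eps_ n)%:E < eps%:E)%E,
          Ev 0%N = setT /\ (forall n, B n (Ev n) /\ (0 < P (Ev n))%E),
          forall n, (0 < n)%N ->
            Ev n `<=` [set w | (Psi n w)%:R <= C * 2 `^ (delta * n%:R)] &
          forall n, exists2 Z : Omega -> R,
            is_cond_probability (cond_proba P (mEv n)) (B n) (Ev n.+1) Z &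
            forall w, Ev n w -> 1 - eps_ n.+1 <= Z w]].

Definition frostman_exponent (kappa : R) : Prop :=
  exists2 C : R, 0 < C & forall t x r, 0 < r < 1 ->
    (eta t (euclidean_ball x r) <= (C * r `^ kappa)%:E)%E.

End random_measures.

Section metric.
Context {R : realType} (Gamma : metricType R).

Definition totally_bounded : Prop :=
  forall r : R, 0 < r ->
    exists s : seq Gamma, forall u, exists2 t, t \in s & ball t r u.

Definition finite_upper_box_dimension : Prop :=
  exists C D : R, forall r : R, 0 < r <= 1 ->
    exists2 s : seq Gamma, (size s)%:R <= C * r `^ (- D) &
      forall u, exists2 t, t \in s & ball t r u.

Definition hoelder_continuous (gamma : R) (f : Gamma -> R) : Prop :=
  exists C : R, forall t u, `|f t - f u| <= C * mdist t u `^ gamma.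

(* Uniform convergence at a rate 2^(- lambda n). *)
Definition unif_exp_cvg (lambda : R) (f : nat -> Gamma -> R) (g : Gamma -> R) :=
  exists C : R, forall n t, `|f n t - g t| <= C * 2 `^ (- lambda * n%:R).

End metric.

(* Main.v *)
Require Import Defs.
From HB Require Import structures.
From mathcomp Require Import all_boot all_order all_algebra.
From mathcomp Require Import all_classical all_reals all_analysis.
From mathcomp Require Import measurable_realfun.
From mathcomp Require Import ring lra zify.
Import Order.TTheory GRing.Theory Num.Theory.
Import numFieldNormedType.Exports.
Local Open Scope classical_set_scope.
Local Open Scope ring_scope.

(** Fix n and t, let Q range over the finitely many dyadic cubes of side
    2^-(n+1) that meet the support of mu_0, and write the increment
    Y_(n+1)^t - Y_n^t as the sum of X_Q = mu_(n+1)^t(Q) - mu_n^t(Q).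
    Conditionally on B_n the X_Q are centred, by the martingale property
    integrated over Q [intersection_mass_martingale].  By (H3), (RM3) and the
    Frostman bound each is O(2^((alpha - kappa) n)), while the sum of their
    absolute values is at most (C + 1) Y_n^t.  Where Psi(n) = O(2^(delta n)),
    X_Q is conditionally independent of all but O(2^(delta n)) of the others.

    These facts bound every even moment of the sum S of the X_Q.  If S' is the
    part of S that is independent of X_Q, then E X_Q S'^(2p+1) = 0, hence
    E X_Q S^(2p+1) = E X_Q (S^(2p+1) - S'^(2p+1)), where S - S' is at most
    Delta = O(2^((alpha + delta - kappa) n)).  Summation over Q bounds the moment
    of order 2p+2 by Delta times a moment of order 2p, and by induction the moment
    of order 2p is O(Delta^p) [moment_bound].  This is applied to S / (1 + Y_n^t),
    for which the bound on the sum of absolute values is deterministic, and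
    Markov's inequality gives, for every p, a bound
    O(2^(-(kappa - alpha - delta - 2 lambda) p n)) for the probability that
    |Y_(n+1)^t - Y_n^t| > 2^(-lambda n) (1 + Y_n^t) [increment_tail].  When
    2 lambda < kappa - alpha - delta, a large p beats the number of points of a
    2^(-a n)-net of Gamma, which is exponential in n by (H1), and the
    Borel-Cantelli lemma applies [net_increments_small].  The events in the
    definition of weak spatial dependence hold simultaneously with probability
    at least 1 - eps, for every eps [chain_escape], so that the conclusion is
    almost sure.

    The rest is deterministic.  With a = (theta + lambda) / gamma0, (H4)
    transports the bound on relative increments from the nets to all of Gamma.
    As the bounds are summable, the Y_n^t are bounded uniformly in n and t, and
    the increments are O(2^(-lambda n)) [pathwise_increments].  Summing them gives
    the uniform exponential convergence; comparing Y^t and Y^u with Y_n^t and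
    Y_n^u for 2^(-a n) close to d(t,u) gives the Hoelder exponent
    gamma = lambda / a [pathwise_conclusion]. *)

Set Implicit Arguments.
Unset Strict Implicit.
Unset Printing Implicit Defensive.

(** * Expectations of bounded and integrable variables *)

Section expectation.
Context d {Omega : measurableType d} {R : realType} (P : probability Omega R).
Implicit Types (f g : Omega -> R) (A : set Omega).

Definition integrable_rv f := P.-integrable setT (EFin \o f).

Definition bounded_rv f :=
  measurable_fun setT f /\ exists C, forall w, `|f w| <= C.

Definition Ex f : R := \int[P]_w f w.

Lemma bounded_rv_integrable f : bounded_rv f -> integrable_rv f.
Proof.
move=> [mf [C fC]]; apply: measurable_bounded_integrable => //.
  by rewrite (le_lt_trans (probability_le1 P measurableT)) ?ltry.
exists C; split; first exact: num_real.
by move=> x Cx w _; exact: (le_trans (fC w) (ltW Cx)).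
Qed.

Lemma bounded_rv_cst (c : R) : bounded_rv (fun=> c).
Proof. by split; [exact: measurable_cst|exists `|c|]. Qed.

Lemma bounded_rv_indic A : measurable A -> bounded_rv (\1_A : Omega -> R).
Proof.
move=> mA; split; first exact: measurable_indic.
by exists 1 => w; rewrite indicE; case: (_ \in _); rewrite ?normr1 ?normr0.
Qed.

Lemma bounded_rvD f g : bounded_rv f -> bounded_rv g ->
  bounded_rv (fun w => f w + g w).
Proof.
move=> [mf [C fC]] [mg [D gD]]; split; first exact: measurable_funD.
by exists (C + D) => w; rewrite (le_trans (ler_normD _ _))// lerD.
Qed.

Lemma bounded_rvM f g : bounded_rv f -> bounded_rv g ->
  bounded_rv (fun w => f w * g w).
Proof.
move=> [mf [C fC]] [mg [D gD]]; split; first exact: measurable_funM.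
by exists (C * D) => w; rewrite normrM ler_pM.
Qed.

Lemma bounded_rvN f : bounded_rv f -> bounded_rv (fun w => - f w).
Proof.
by move=> [mf [C fC]]; split; [exact: measurable_funN|exists C => w; rewrite normrN].
Qed.

Lemma bounded_rvB f g : bounded_rv f -> bounded_rv g ->
  bounded_rv (fun w => f w - g w).
Proof. by move=> bf bg; apply: bounded_rvD => //; exact: bounded_rvN. Qed.

Lemma bounded_rvX f n : bounded_rv f -> bounded_rv (fun w => f w ^+ n).
Proof.
move=> [mf [C fC]]; split; first exact: measurable_funX.
by exists (C ^+ n) => w; rewrite normrX lerXn2r// nnegrE// (le_trans _ (fC w)).
Qed.

Lemma bounded_rv_norm f : bounded_rv f -> bounded_rv (fun w => `|f w|).
Proof.
move=> [mf [C fC]]; split; first exact: measurableT_comp.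
by exists C => w; rewrite normr_id.
Qed.

Lemma bounded_rv_sum (I : Type) (s : seq I) (Q : pred I) (f : I -> Omega -> R) :
  (forall i, bounded_rv (f i)) -> bounded_rv (fun w => \sum_(i <- s | Q i) f i w).
Proof.
move=> bf; elim: s => [|i s ih].
  under eq_fun do rewrite big_nil; exact: bounded_rv_cst.
under eq_fun do rewrite big_cons.
by case: (Q i) => //; exact: bounded_rvD.
Qed.

Lemma ExD f g : integrable_rv f -> integrable_rv g ->
  Ex (fun w => f w + g w) = Ex f + Ex g.
Proof. by move=> ? ?; rewrite /Ex RintegralD. Qed.

Lemma ExB f g : integrable_rv f -> integrable_rv g ->
  Ex (fun w => f w - g w) = Ex f - Ex g.
Proof. by move=> ? ?; rewrite /Ex RintegralB. Qed.

Lemma ExZ (c : R) f : integrable_rv f -> Ex (fun w => c * f w) = c * Ex f.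
Proof. by move=> ?; rewrite /Ex RintegralZl. Qed.

Lemma Ex_sum (I : Type) (s : seq I) (Q : pred I) (f : I -> Omega -> R) :
  (forall i, integrable_rv (f i)) ->
  Ex (fun w => \sum_(i <- s | Q i) f i w) = \sum_(i <- s | Q i) Ex (f i).
Proof.
move=> bf; rewrite /Ex /Rintegral.
under eq_integral do rewrite -sumEFin.
rewrite integral_sum//.
rewrite (_ : (\sum_(i <- s | Q i) _)%E = (\sum_(i <- s | Q i) Ex (f i))%:E)//.
rewrite -sumEFin; apply: eq_bigr => i _.
by rewrite fineK//; exact: (integrable_fin_num measurableT (bf i)).
Qed.

Lemma integrable_rv_sum (I : Type) (s : seq I) (Q : pred I) (f : I -> Omega -> R) :
  (forall i, integrable_rv (f i)) ->
  integrable_rv (fun w => \sum_(i <- s | Q i) f i w).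
Proof.
move=> intf; rewrite /integrable_rv.
rewrite (_ : _ \o _ = (fun w => \sum_(i <- s | Q i) (EFin \o f i) w)%E).
  by apply: integrable_sum => // i _; exact: intf.
by apply/funext => w /=; rewrite sumEFin.
Qed.

Lemma Ex_le f g : integrable_rv f -> integrable_rv g ->
  (forall w, f w <= g w) -> Ex f <= Ex g.
Proof. by move=> ? ? fg; apply: le_Rintegral. Qed.

Lemma eq_Ex f g : f =1 g -> Ex f = Ex g.
Proof. by move=> /funext ->. Qed.

Lemma Ex_indic A : measurable A -> (Ex \1_A)%:E = P A.
Proof.
move=> mA; rewrite /Ex /Rintegral fineK; last first.
  by apply: integrable_fin_num => //; apply: bounded_rv_integrable; exact: bounded_rv_indic.
by rewrite integral_indic// setIT.
Qed.

Lemma Ex_ae_eq f g : integrable_rv f -> measurable_fun setT g ->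
  {ae P, forall w, f w = g w} -> Ex f = Ex g.
Proof.
move=> intf mg fg; rewrite /Ex /Rintegral; congr fine.
apply: ae_eq_integral => //.
- exact: measurable_int intf.
- exact/measurable_EFinP.
- by apply: filterS fg => w fgw _ /=; rewrite fgw.
Qed.

Lemma integrable_rvM f g : bounded_rv f -> integrable_rv g ->
  integrable_rv (fun w => f w * g w).
Proof.
move=> [mf [C fC]] ig; apply: (@integrableMr _ _ _ P setT measurableT f (EFin \o g)) => //.
exists C; split; first exact: num_real.
by move=> x Cx w _; exact: (le_trans (fC w) (ltW Cx)).
Qed.

Lemma integrable_rvMr f g : integrable_rv f -> bounded_rv g ->
  integrable_rv (fun w => f w * g w).
Proof.
by move=> intf bg; under eq_fun do rewrite mulrC; exact: integrable_rvM.
Qed.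

Lemma integrable_rvB f g : integrable_rv f -> integrable_rv g ->
  integrable_rv (fun w => f w - g w).
Proof. by move=> intf ig; exact: (@integrableB _ _ _ P setT measurableT (EFin \o f) (EFin \o g)). Qed.

Lemma Ex_setint A f : measurable A ->
  (\int[P]_(w in A) f w) = Ex (fun w => \1_A w * f w).
Proof.
move=> mA; rewrite Rintegral_mkcond; apply: eq_Ex => w.
by rewrite patchE indicE; case: (w \in A); rewrite ?mul1r ?mul0r.
Qed.

End expectation.

(** * Orthogonality to a sigma-algebra *)

Section sub_sigma_algebra.
Context d {Omega : measurableType d} {R : realType} (P : probability Omega R).
Variable G : set (set Omega).
Hypothesis sG : sigma_algebra setT G.
Hypothesis GO : G `<=` measurable.

Lemma sub_measurable_fun d' (T : sigmaRingType d') (f : Omega -> T) :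
  measurable_fun [set: g_sigma_algebraType G] f -> measurable_fun setT f.
Proof.
move=> mf mT A mA; apply: GO; rewrite -(sigma_algebra_id sG).
exact: mf.
Qed.

Lemma sub_measurable_indic A : G A ->
  measurable_fun [set: g_sigma_algebraType G] (\1_A : Omega -> R).
Proof. by move=> GA; apply: measurable_indic; exact: sub_sigma_algebra. Qed.

Lemma sub_measurable_ge0 (f : Omega -> R) :
  measurable_fun [set: g_sigma_algebraType G] f -> G [set w | 0 <= f w].
Proof.
move=> mf; rewrite -[G](sigma_algebra_id sG) -[X in <<s _>> X]setTI.
rewrite [X in _ `&` X](_ : _ = f @^-1` `[0, +oo[%classic).
  by apply: mf => //; exact: measurable_itv.
by apply/seteqP; split => w /=; rewrite in_itv/= andbT.
Qed.

Import HBNNSimple.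

(** The approximants of g are linear combinations of indicators of sets of G
    and increase to g, so that |f g| dominates. *)
Let orthogonal_ge0 (f g : Omega -> R) : integrable_rv P f ->
  measurable_fun [set: g_sigma_algebraType G] g ->
  integrable_rv P (fun w => f w * g w) ->
  (forall w, 0 <= g w) ->
  (forall A, G A -> Ex P (fun w => f w * \1_A w) = 0) ->
  Ex P (fun w => f w * g w) = 0.
Proof.
move=> intf mg intfg g0 fG.
have mge : measurable_fun [set: g_sigma_algebraType G] (EFin \o g).
  exact/measurable_EFinP.
pose phi := @nnsfun_approx _ (g_sigma_algebraType G) R setT measurableT _ mge.
pose psi n : Omega -> R := fun w => phi n w.
have bphi n : bounded_rv (psi n).
  split.
    by apply: sub_measurable_fun; exact: (@measurable_funPT _ _ _ _ (phi n)).
  have [M [_ HM]] := simple_bounded (phi n).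
  by exists (M + 1) => w; apply: HM => //; rewrite ltrDl.
have Ephi n : Ex P (fun w => f w * psi n w) = 0.
  pose slice k := @dyadic_approx _ (g_sigma_algebraType G) R setT (EFin \o g) n k.
  pose top := @integer_approx _ (g_sigma_algebraType G) R setT (EFin \o g) n.
  rewrite (_ : (fun w => _) = (fun w =>
     \sum_(k < n * 2 ^ n) (k%:R * 2 ^- n) *
       (f w * \1_(slice k) w)
     + n%:R * (f w * \1_top w))); last first.
    apply/funext => w; rewrite /psi /phi nnsfun_approxE /approx mulrDr mulr_sumr.
    congr (_ + _); last by rewrite mulrCA.
    by apply: eq_bigr => k _; rewrite mulrCA.
  have GA k : G (slice k).
    rewrite -[G](sigma_algebra_id sG) /slice /dyadic_approx; case: ifPn => // _.
      rewrite -preimage_comp.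
      by have := mge; apply => //; apply/measurable_image_EFin; exact: measurable_itv.
    exact: (@measurable0 _ (g_sigma_algebraType G)).
  have GB : G top.
    rewrite -[G](sigma_algebra_id sG) /top /integer_approx.
    by have := @emeasurable_fun_c_infty _ (g_sigma_algebraType G) R setT (EFin \o g) measurableT mge n%:R%:E; exact.
  have iA k : integrable_rv P (fun w => f w *
      \1_(slice k) w).
    by apply: integrable_rvMr => //; apply: bounded_rv_indic; exact: GO.
  have iB : integrable_rv P (fun w => f w *
      \1_top w).
    by apply: integrable_rvMr => //; apply: bounded_rv_indic; exact: GO.
  have iZ (c : R) (h : Omega -> R) : integrable_rv P h -> integrable_rv P (fun w => c * h w).
    by move=> ih; apply: integrable_rvM => //; exact: bounded_rv_cst.
  rewrite ExD.
  - rewrite Ex_sum; last by move=> k; exact: iZ.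
    rewrite ExZ// fG// mulr0 addr0 big1// => k _.
    by rewrite ExZ// fG// mulr0.
  - by apply: integrable_rv_sum => k; exact: iZ.
  - exact: iZ.
have m1 n : measurable_fun setT (fun w => (f w * psi n w)%:E).
  by apply: (measurable_int P); exact: integrable_rvMr.
have m2 : measurable_fun setT (fun w => (f w * g w)%:E) by exact: (measurable_int P).
have c1 : {ae P, forall w, setT w ->
    (f w * psi n w)%:E @[n --> \oo] --> (f w * g w)%:E}.
  apply: aeW => w _; under eq_fun do rewrite EFinM; rewrite EFinM.
  apply: cvgeZl => //.
  by apply: (cvg_nnsfun_approx measurableT mge) => // x _; rewrite /= lee_fin.
have c2 : {ae P, forall w n, setT w ->
    (`|(f w * psi n w)%:E| <= `|(f w * g w)%:E|)%E}.
  apply: aeW => w n _; rewrite !abse_EFin lee_fin !normrM ler_wpM2l//.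
  rewrite ger0_norm /psi// ger0_norm// -lee_fin /phi nnsfun_approxE.
  by apply: (@le_approx _ (g_sigma_algebraType G) R setT (EFin \o g)) => // x _;
    rewrite /= lee_fin.
have [_ _ cvgE] := dominated_convergence measurableT m1 m2 c1
  (integrable_abse intfg) c2.
rewrite /Ex /Rintegral -(cvg_lim _ cvgE)//.
rewrite (_ : (fun n => _) = cst 0%E) ?lim_cst//.
apply/funext => n /=; rewrite -[0%E]/((0 : R)%:E) -(Ephi n) /Ex /Rintegral fineK//.
by apply: integrable_fin_num => //; apply: integrable_rvMr.
Qed.

(** Integrability of f g is what dominated convergence needs; asking for it
    instead of boundedness of g lets g be a version of a conditional
    probability. *)
Lemma Ex_orthogonal (f g : Omega -> R) : integrable_rv P f ->
  measurable_fun [set: g_sigma_algebraType G] g ->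
  integrable_rv P (fun w => f w * g w) ->
  (forall A, G A -> Ex P (fun w => f w * \1_A w) = 0) ->
  Ex P (fun w => f w * g w) = 0.
Proof.
move=> intf mg intfg fG.
pose U := [set w | 0 <= g w].
have GU : G U by exact: sub_measurable_ge0.
have bU : bounded_rv (\1_U : Omega -> R) by apply: bounded_rv_indic; exact: GO.
have pos : forall w, 0 <= g w * \1_U w.
  move=> w; rewrite indicE; case: (boolP (w \in U)); rewrite ?mulr0// mulr1.
  by rewrite inE.
have neg : forall w, 0 <= - (g w * (1 - \1_U w)).
  move=> w; rewrite indicE; case: (boolP (w \in U)); rewrite ?subrr ?mulr0 ?oppr0//.
  by rewrite addr0 mulr1 notin_setE /U/= => /negP; rewrite -ltNge oppr_ge0 => /ltW.
have mU : measurable_fun [set: g_sigma_algebraType G] (\1_U : Omega -> R).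
  exact: sub_measurable_indic.
have i1 : integrable_rv P (fun w => f w * (g w * \1_U w)).
  by under eq_fun do rewrite mulrA; exact: integrable_rvMr.
have i2 : integrable_rv P (fun w => f w * - (g w * (1 - \1_U w))).
  under eq_fun do rewrite mulrN mulrA -mulrN.
  apply: integrable_rvMr => //; apply: bounded_rvN; apply: bounded_rvB => //.
  exact: bounded_rv_cst.
transitivity (Ex P (fun w => f w * (g w * \1_U w))
  - Ex P (fun w => f w * - (g w * (1 - \1_U w)))).
  rewrite -ExB//; apply: eq_Ex => w.
  by rewrite mulrN opprK -mulrDr -mulrDr addrCA subrr addr0 mulr1.
rewrite !orthogonal_ge0 ?subrr//.
  apply: measurable_funN; apply: measurable_funM => //; apply: measurable_funB => //.
by apply: measurable_funM.
Qed.

End sub_sigma_algebra.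

(** * Moments of sums over a dependency graph *)

Section power_inequalities.
Context {R : realType}.
Implicit Types (a b M : R).

Lemma norm_exprB_le (m : nat) a b M : `|a| <= M -> `|b| <= M ->
  `|a ^+ m.+1 - b ^+ m.+1| <= m.+1%:R * `|a - b| * M ^+ m.
Proof.
move=> aM bM; have M0 : 0 <= M := le_trans (normr_ge0 a) aM.
rewrite subrXX normrM (mulrC m.+1%:R) -mulrA ler_wpM2l//.
rewrite (le_trans (ler_norm_sum _ _ _))//.
rewrite [leRHS](_ : _ = \sum_(i < m.+1) M ^+ m); last first.
  by rewrite sumr_const card_ord mulr_natl.
apply: ler_sum => i _; rewrite normrM !normrX.
have -> : M ^+ m = M ^+ (m.+1.-1 - i) * M ^+ i.
  by rewrite -exprD /= subnK// -ltnS ltn_ord.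
by apply: ler_pM; rewrite ?exprn_ge0//; apply: lerXn2r; rewrite ?nnegrE.
Qed.

Lemma exprD_even_le (p : nat) a b : 0 <= b ->
  (`|a| + b) ^+ (2 * p) <= 4 ^+ p * (a ^+ (2 * p) + b ^+ (2 * p)).
Proof.
move=> b0; rewrite !exprM.
have h : (`|a| + b) ^+ 2 <= 4 * Num.max (a ^+ 2) (b ^+ 2).
  rewrite -[a ^+ 2]real_normK ?num_real//.
  have := normr_ge0 a; move: `|a| => c c0.
  have [|] := leP (c ^+ 2) (b ^+ 2); nra.
have a0 : 0 <= a ^+ 2 := sqr_ge0 a; have b02 := sqr_ge0 b.
have m0 : 0 <= Num.max (a ^+ 2) (b ^+ 2) by rewrite le_max a0.
rewrite (le_trans (lerXn2r p _ _ h)) ?nnegrE ?sqr_ge0 ?mulr_ge0//.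
rewrite exprMn ler_wpM2l ?exprn_ge0//.
by have [|] := leP (a ^+ 2) (b ^+ 2) => _; rewrite ?lerDl ?lerDr exprn_ge0.
Qed.

End power_inequalities.

(** The factor 2 q + 1 comes from the difference of two powers of exponent
    2 q + 1, the factor 4 ^ q from expanding (|S| + Delta)^(2 q). *)
Fixpoint moment_const (p : nat) : nat :=
  if p is q.+1 then (2 * q + 1) * 4 ^ q * (moment_const q + 1) else 1.

Section moments.
Context d {Omega : measurableType d} {R : realType} (P : probability Omega R).
Context (I : finType) (X : I -> Omega -> R) (N : Omega -> I -> {set I}).
Variables (A : set Omega) (D : nat) (r V : R).
Hypothesis bX : forall i, bounded_rv (X i).
Hypothesis mN : forall i J, measurable [set w | N w i = J].
Hypothesis mA : measurable A.
Hypothesis orthoX : forall i J k,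
  Ex P (fun w => \1_(A `&` [set w | N w i = J]) w *
                 (X i w * (\sum_(j | j \notin J) X j w) ^+ k)) = 0.
Hypothesis degN : forall w, A w -> forall i, (#|N w i| <= D)%N.
Hypothesis r0 : 0 <= r.
Hypothesis V0 : 0 <= V.
Hypothesis Xr : forall w, A w -> forall i, `|X i w| <= r.
Hypothesis XV : forall w, A w -> \sum_i `|X i w| <= V.

Let Delta := D%:R * r.
Let S w := \sum_i X i w.
(** On [N w i = J] this is a sum over the fixed set of indices outside J,
    to which the orthogonality hypothesis applies. *)
Let far w i := \sum_(j | j \notin N w i) X j w.

Let Delta0 : 0 <= Delta. Proof. by rewrite mulr_ge0. Qed.

Let bS : bounded_rv S. Proof. exact: bounded_rv_sum. Qed.

Let farE i k w : \1_A w * (X i w * far w i ^+ k) =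
  \sum_J \1_(A `&` [set w | N w i = J]) w *
                 (X i w * (\sum_(j | j \notin J) X j w) ^+ k).
Proof.
rewrite (bigD1 (N w i))//= [X in _ + X]big1 ?addr0; last first.
  move=> J JN; rewrite indicE memNset ?mul0r//= => -[_ NJ].
  by rewrite NJ eqxx in JN.
congr (_ * _); rewrite !indicE; congr (_ %:R); congr nat_of_bool.
by apply/idP/idP; rewrite !inE/= => // -[].
Qed.

Let bfar i k : bounded_rv (fun w => \1_A w * (X i w * far w i ^+ k)).
Proof.
rewrite (funext (farE i k)); apply: bounded_rv_sum => J.
apply: bounded_rvM; first by apply: bounded_rv_indic; exact: measurableI.
by apply: bounded_rvM => //; apply: bounded_rvX; exact: bounded_rv_sum.
Qed.

Let Ex_far i k : Ex P (fun w => \1_A w * (X i w * far w i ^+ k)) = 0.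
Proof.
rewrite (eq_Ex P (farE i k)) Ex_sum; first by rewrite big1.
move=> J; apply: bounded_rv_integrable.
apply: bounded_rvM; first by apply: bounded_rv_indic; exact: measurableI.
by apply: bounded_rvM => //; apply: bounded_rvX; exact: bounded_rv_sum.
Qed.

Let near_le w i : A w -> `|S w - far w i| <= Delta.
Proof.
move=> Aw; rewrite /S (bigID (mem (N w i)))/= addrK.
rewrite (le_trans (ler_norm_sum _ _ _))//.
rewrite (le_trans (ler_sum _ (fun j _ => Xr Aw j)))//.
by rewrite sumr_const -mulr_natl ler_wpM2r// ler_nat degN.
Qed.

(** As X i is orthogonal to the powers of the far sum, S ^ (2p+1) can be replaced
    in E X_i S^(2p+1) by its difference with far_i ^ (2p+1), which is of order
    Delta (|S| + Delta)^(2p). *)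
Let moment_step p :
  Ex P (fun w => \1_A w * S w ^+ (2 * p.+1)) <=
  (2 * p + 1)%:R * V * Delta * Ex P (fun w => \1_A w * (`|S w| + Delta) ^+ (2 * p)).
Proof.
have bA : bounded_rv (\1_A : Omega -> R) by exact: bounded_rv_indic.
have bR : bounded_rv (fun w => \1_A w * (`|S w| + Delta) ^+ (2 * p)).
  apply: bounded_rvM => //; apply: bounded_rvX; apply: bounded_rvD.
    exact: bounded_rv_norm.
  exact: bounded_rv_cst.
have bXS i : bounded_rv (fun w => \1_A w * (X i w * S w ^+ (2 * p).+1)).
  by apply: bounded_rvM => //; apply: bounded_rvM => //; exact: bounded_rvX.
(* Subtracting the far terms does not change the expectation. *)
have -> : Ex P (fun w => \1_A w * S w ^+ (2 * p.+1)) =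
    Ex P (fun w => \sum_i (\1_A w * (X i w * S w ^+ (2 * p).+1)
                   - \1_A w * (X i w * far w i ^+ (2 * p).+1))).
  transitivity (\sum_i Ex P (fun w => \1_A w * (X i w * S w ^+ (2 * p).+1))).
    rewrite -Ex_sum; last by move=> i; exact: bounded_rv_integrable.
    apply: eq_Ex => w; rewrite -mulr_sumr -mulr_suml -exprS.
    by rewrite mulnS.
  rewrite Ex_sum; last first.
    by move=> i; apply: bounded_rv_integrable; exact: bounded_rvB.
  apply: eq_bigr => i _; rewrite ExB; try exact: bounded_rv_integrable.
  by rewrite Ex_far subr0.
rewrite -ExZ; last exact: bounded_rv_integrable.
apply: Ex_le.
- apply: bounded_rv_integrable; apply: bounded_rv_sum => i.
  exact: bounded_rvB.
- by apply: bounded_rv_integrable; apply: bounded_rvM => //; exact: bounded_rv_cst.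
move=> w; rewrite indicE; case: (boolP (w \in A)); last first.
  by move=> _; rewrite !mul0r mulr0 big1// => i _; rewrite !mul0r subr0.
rewrite inE => Aw; under eq_bigr do rewrite !mul1r -mulrBr.
rewrite mul1r -[(2 * p + 1)%:R * V]mulrC -2!mulrA.
apply: (@le_trans _ _ (\sum_i `|X i w| *
    ((2 * p + 1)%:R * (Delta * (`|S w| + Delta) ^+ (2 * p))))); last first.
  by rewrite -mulr_suml ler_wpM2r ?XV// !mulr_ge0// exprn_ge0// addr_ge0.
apply: ler_sum => i _; rewrite (le_trans (ler_norm _))// normrM ler_wpM2l//.
rewrite (le_trans (norm_exprB_le (M := `|S w| + Delta) (2 * p) _ _))//.
- by rewrite lerDl.
- rewrite -[far w i](subrKC (S w)) (le_trans (ler_normD _ _))// lerD2l.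
  by rewrite distrC near_le.
rewrite addn1 -mulrA ler_wpM2l// ler_wpM2r ?near_le//.
by rewrite exprn_ge0// addr_ge0.
Qed.

(** Iteration of the recursion.  The term Delta ^ 2 accounts for the moment of
    |S| + Delta, instead of S, that each step produces. *)
Lemma moment_bound p : Ex P (fun w => \1_A w * S w ^+ (2 * p)) <=
  (moment_const p)%:R * (V * Delta + Delta ^+ 2) ^+ p.
Proof.
have bA : bounded_rv (\1_A : Omega -> R) by exact: bounded_rv_indic.
have U0 : 0 <= V * Delta + Delta ^+ 2 by rewrite addr_ge0 ?sqr_ge0 ?mulr_ge0.
elim: p => [|p ih].
  rewrite mul1r expr0 (_ : (fun w => _) = (\1_A : _ -> R)); last first.
    by apply/funext => w; rewrite expr0 mulr1.
  by rewrite -lee_fin Ex_indic// probability_le1.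
apply: (le_trans (moment_step p)).
have bS2 : bounded_rv (fun w => \1_A w * S w ^+ (2 * p)).
  by apply: bounded_rvM => //; exact: bounded_rvX.
have {ih}le1 : Ex P (fun w => \1_A w * (`|S w| + Delta) ^+ (2 * p)) <=
    4 ^+ p * ((moment_const p)%:R * (V * Delta + Delta ^+ 2) ^+ p +
              (V * Delta + Delta ^+ 2) ^+ p).
  apply: (@le_trans _ _ (4 ^+ p * (Ex P (fun w => \1_A w * S w ^+ (2 * p))
     + Delta ^+ (2 * p)))); last first.
    rewrite ler_wpM2l ?exprn_ge0// lerD// exprM lerXn2r// ?nnegrE ?sqr_ge0//.
    by rewrite lerDr mulr_ge0.
  have -> : Delta ^+ (2 * p) = Ex P (fun w => Delta ^+ (2 * p)).
    rewrite /Ex Rintegral_cst// (_ : fine _ = 1) ?mulr1//.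
    by have := @probability_setT _ _ _ P; rewrite /= => ->.
  rewrite -ExD; [|exact: bounded_rv_integrable|
    by apply: bounded_rv_integrable; exact: bounded_rv_cst].
  rewrite -ExZ; last first.
    by apply: bounded_rv_integrable; apply: bounded_rvD => //; exact: bounded_rv_cst.
  apply: Ex_le.
  - apply: bounded_rv_integrable; apply: bounded_rvM => //; apply: bounded_rvX.
    by apply: bounded_rvD; [exact: bounded_rv_norm|exact: bounded_rv_cst].
  - apply: bounded_rv_integrable; apply: bounded_rvM; first exact: bounded_rv_cst.
    by apply: bounded_rvD => //; exact: bounded_rv_cst.
  move=> w; rewrite indicE; case: (w \in A).
    by rewrite !mul1r exprD_even_le.
  by rewrite !mul0r add0r mulr_ge0 ?exprn_ge0.
apply: (le_trans (ler_wpM2l _ le1)); first by rewrite !mulr_ge0.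
rewrite /= !natrM natrX [(moment_const p + 1)%:R]natrD.
set U := V * Delta + Delta ^+ 2 in U0 *.
set m := (2 * p + 1)%:R; set c := (moment_const p)%:R.
rewrite [leLHS](_ : _ = (V * Delta) * (m * 4 ^+ p * (c + 1) * U ^+ p)); last by ring.
rewrite [leRHS](_ : _ = U * (m * 4 ^+ p * (c + 1) * U ^+ p)); last first.
  by rewrite exprS; ring.
rewrite ler_wpM2r//; last by rewrite lerDl sqr_ge0.
have m0 : 0 <= m by []. have c0 : 0 <= c by [].
by apply: mulr_ge0; rewrite ?exprn_ge0// !mulr_ge0 ?exprn_ge0// addr_ge0.
Qed.

End moments.

(** * Conditional independence *)

Section cond_expectation.
Context d {Omega : measurableType d} {R : realType} (P : probability Omega R).
Variable G : set (set Omega).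
Hypothesis sG : sigma_algebra setT G.
Hypothesis GO : G `<=` measurable.

Lemma sigma_algebraI2 (A B : set Omega) : G A -> G B -> G (A `&` B).
Proof.
rewrite -(sigma_algebra_id sG) => GA GB.
exact: (@measurableI _ (g_sigma_algebraType G)).
Qed.

Lemma cond_expectation_Ex (X Z : Omega -> R) : is_cond_expectation P G X Z ->
  forall A, G A -> Ex P (fun w => (X w - Z w) * \1_A w) = 0.
Proof.
move=> [iX iZ _ XZ] A GA; have mA := GO GA.
have bA : bounded_rv (\1_A : Omega -> R) by exact: bounded_rv_indic.
transitivity (Ex P (fun w => \1_A w * X w) - Ex P (fun w => \1_A w * Z w)).
  rewrite -ExB; [|exact: integrable_rvM..].
  by apply: eq_Ex => w; rewrite mulrBl !(mulrC (\1_A w)).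
by rewrite -!Ex_setint// /Rintegral XZ// subrr.
Qed.

(** Z - Z' integrates to zero over the sets where it has constant sign, because
    these belong to G. *)
Lemma cond_expectation_uniq (X Z Z' : Omega -> R) :
  is_cond_expectation P G X Z -> is_cond_expectation P G X Z' ->
  Ex P (fun w => `|Z w - Z' w|) = 0.
Proof.
move=> cZ cZ'; have [iX iZ mZ _] := cZ; have [_ iZ' mZ' _] := cZ'.
have mB : measurable_fun [set: g_sigma_algebraType G] (fun w => Z w - Z' w).
  exact: measurable_funB.
have iB : integrable_rv P (fun w => Z w - Z' w) by exact: integrable_rvB.
pose U := [set w | 0 <= Z w - Z' w].
have GU : G U by exact: sub_measurable_ge0.
have GV : G (~` U).
  rewrite -[G](sigma_algebra_id sG); apply: sigma_algebraC.
  by rewrite (sigma_algebra_id sG).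
have E0 A : G A -> Ex P (fun w => (Z w - Z' w) * \1_A w) = 0.
  move=> GA; have bA : bounded_rv (\1_A : Omega -> R) by apply: bounded_rv_indic; exact: GO.
  transitivity (Ex P (fun w => (X w - Z' w) * \1_A w)
              - Ex P (fun w => (X w - Z w) * \1_A w)).
    rewrite -ExB; try by apply: integrable_rvMr => //; exact: integrable_rvB.
    by apply: eq_Ex => w; ring.
  by rewrite !cond_expectation_Ex// subrr.
transitivity (Ex P (fun w => (Z w - Z' w) * \1_U w)
            - Ex P (fun w => (Z w - Z' w) * \1_(~` U) w)); last by rewrite !E0// subrr.
have bU : bounded_rv (\1_U : Omega -> R) by apply: bounded_rv_indic; exact: GO.
have bV : bounded_rv (\1_(~` U) : Omega -> R) by apply: bounded_rv_indic; exact: GO.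
rewrite -ExB; [|exact: integrable_rvMr..].
apply: eq_Ex => w; rewrite !indicE in_setC; case: (boolP (w \in U)) => /=.
  by rewrite inE mulr0 subr0 mulr1 => Uw; rewrite ger0_norm.
rewrite notin_setE /U/= => /negP; rewrite -ltNge => /ltW h.
by rewrite ler0_norm// mulr0 sub0r mulr1.
Qed.

End cond_expectation.

Section conditional_independence.
Context d {Omega : measurableType d} {R : realType} (P : probability Omega R).
Variables G U V : set (set Omega).
Hypothesis sG : sigma_algebra setT G.
Hypothesis GO : G `<=` measurable.
Hypothesis sU : sigma_algebra setT U.
Hypothesis UO : U `<=` measurable.
Hypothesis sV : sigma_algebra setT V.
Hypothesis VO : V `<=` measurable.
Variable A : set Omega.
Hypothesis indep : cond_independent_on P G A U V.
Variables z m : Omega -> R.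
Hypothesis bz : bounded_rv z.
Hypothesis mz : measurable_fun [set: g_sigma_algebraType U] z.
Hypothesis czm : is_cond_expectation P G z m.
Hypothesis bm : bounded_rv m.

Let mm : measurable_fun [set: g_sigma_algebraType G] m.
Proof. by case: czm. Qed.

(** Conditional independence provides versions of the conditional probabilities
    that depend on the pair (E, F).  The version Y of P(F | G) is fixed by taking
    for E the whole space, and uniqueness identifies it with the others.  Then
    z - m integrates to zero against Y, and on W the difference of the indicator
    of F and Y integrates to zero against both z and m. *)
Let cond_indep_set (F W : set Omega) : V F -> G W -> W `<=` A ->
  Ex P (fun w => (\1_W w * (z w - m w)) * \1_F w) = 0.
Proof.
move=> VF GW WA.
have UT : U setT.
  by rewrite -(sigma_algebra_id sU); exact: (@measurableT _ (g_sigma_algebraType U)).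
have [_ [Y [_ [_ cY _ _]]]] := indep UT VF.
have [iF iY mY _] := cY.
have bW : bounded_rv (\1_W : Omega -> R) by apply: bounded_rv_indic; exact: GO.
have mW : measurable_fun [set: g_sigma_algebraType G] (\1_W : Omega -> R).
  exact: sub_measurable_indic.
have bF : bounded_rv (\1_F : Omega -> R) by apply: bounded_rv_indic; exact: VO.
have iFY : integrable_rv P (fun w => \1_F w - Y w) by exact: integrable_rvB.
have key E : U E -> Ex P (fun w => \1_W w * (\1_F w - Y w) * \1_E w) = 0.
  move=> UE; have [ZE [ZF [ZEF [cE cF cEF eqE]]]] := indep UE VF.
  have [iE iZE mZE _] := cE; have [_ iZF mZF _] := cF; have [iEF iZEF mZEF _] := cEF.
  have bE : bounded_rv (\1_E : Omega -> R) by apply: bounded_rv_indic; exact: UO.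
  have ae1 : {ae P, forall w, \1_W w * ZEF w = \1_W w * (ZE w * ZF w)}.
    apply: filterS eqE => w /= h; rewrite indicE.
    case: (boolP (w \in W)) => [|_]; last by rewrite !mul0r.
    by rewrite inE => /WA /h ->.
  have mZE' := sub_measurable_fun sG GO mZE.
  have mZF' := sub_measurable_fun sG GO mZF.
  have mW' : measurable_fun setT (\1_W : Omega -> R) by case: bW.
  have mEF : measurable_fun setT (fun w => \1_W w * (ZE w * ZF w)).
    by apply: measurable_funM => //; exact: measurable_funM.
  have iWEF : integrable_rv P (fun w => \1_W w * ZEF w) by exact: integrable_rvM.
  have iEF' : integrable_rv P (fun w => \1_W w * (ZE w * ZF w)).
    apply/integrableP; split; first exact/measurable_EFinP.
    have /integrableP[_] := iWEF; apply: le_lt_trans.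
    rewrite le_eqVlt; apply/orP; left; apply/eqP; apply: ae_eq_integral => //.
    - by do 2 apply: measurableT_comp => //.
    - apply: measurableT_comp => //; apply: measurableT_comp => //.
      by have [+ _] := (integrableP _ _ _ iWEF) => /measurable_EFinP.
    - by apply: filterS ae1 => w /= -> _.
  have e1 : Ex P (fun w => \1_W w * ZEF w) = Ex P (fun w => \1_W w * (ZE w * ZF w)).
    exact: Ex_ae_eq.
  have e2 : Ex P (fun w => (\1_(E `&` F) w - ZEF w) * \1_W w) = 0.
    by have := cond_expectation_Ex GO cEF GW.
  have i3 : integrable_rv P (fun w => (\1_E w - ZE w) * (\1_W w * ZF w)).
    under eq_fun do rewrite mulrBl mulrCA (mulrCA (ZE _)).
    apply: integrable_rvB => //.
    by apply: integrable_rvM => //; exact: integrable_rvM.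
  have e3 : Ex P (fun w => (\1_E w - ZE w) * (\1_W w * ZF w)) = 0.
    apply: (Ex_orthogonal sG GO) => //.
    - by apply: integrable_rvB.
    - by apply: measurable_funM.
    - exact: (cond_expectation_Ex GO cE).
  have iYF : integrable_rv P (fun w => ZF w - Y w) by exact: integrable_rvB.
  have e4 : Ex P (fun w => \1_W w * (ZF w - Y w) * \1_E w) = 0.
    apply/eqP; rewrite -normr_le0.
    rewrite -(cond_expectation_uniq sG GO cF cY).
    have i4 : integrable_rv P (fun w => \1_W w * (ZF w - Y w) * \1_E w).
      by apply: integrable_rvMr => //; exact: integrable_rvM.
    rewrite /Ex (le_trans (le_normr_Rintegral _ _))//.
    apply: le_Rintegral => //.
    - exact: integrable_norm.
    - exact: integrable_norm.
    move=> w _; rewrite !normrM !indicE.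
    case: (w \in W); case: (w \in E); rewrite ?normr0 ?mulr0 ?mul0r ?normr1 ?mul1r ?mulr1//.
  have i2 : integrable_rv P (fun w => (\1_(E `&` F) w - ZEF w) * \1_W w).
    by apply: integrable_rvMr => //; exact: integrable_rvB.
  have i4 : integrable_rv P (fun w => \1_W w * (ZF w - Y w) * \1_E w).
    by apply: integrable_rvMr => //; exact: integrable_rvM.
  transitivity (Ex P (fun w => (\1_(E `&` F) w - ZEF w) * \1_W w)
    + (Ex P (fun w => \1_W w * ZEF w) - Ex P (fun w => \1_W w * (ZE w * ZF w)))
    - Ex P (fun w => (\1_E w - ZE w) * (\1_W w * ZF w))
    + Ex P (fun w => \1_W w * (ZF w - Y w) * \1_E w)); last first.
    by rewrite e2 e1 e3 e4 subrr subr0 !addr0.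
  rewrite -(ExB iWEF iEF') -ExD//; last exact: integrable_rvB.
  have i5 : integrable_rv P (fun w => \1_W w * ZEF w - \1_W w * (ZE w * ZF w)).
    exact: integrable_rvB.
  rewrite -ExB//; last first.
    exact: (@integrableD _ _ _ P setT measurableT (EFin \o _) (EFin \o _)).
  rewrite -ExD//; last first.
    apply: integrable_rvB => //.
    exact: (@integrableD _ _ _ P setT measurableT (EFin \o _) (EFin \o _)).
  by apply: eq_Ex => w; rewrite indicI/=; ring.
have s1 : Ex P (fun w => (\1_W w * (\1_F w - Y w)) * z w) = 0.
  apply: (Ex_orthogonal sU UO) => //.
  - exact: integrable_rvM.
  - by apply: integrable_rvMr => //; exact: integrable_rvM.
have iY' : integrable_rv P (fun w => \1_W w * Y w) by exact: integrable_rvM.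
have bzm : bounded_rv (fun w => z w - m w) by exact: bounded_rvB.
have s2 : Ex P (fun w => (z w - m w) * (\1_W w * Y w)) = 0.
  apply: (Ex_orthogonal sG GO) => //.
  - exact: bounded_rv_integrable.
  - exact: measurable_funM.
  - exact: integrable_rvM.
  - exact: (cond_expectation_Ex GO czm).
have bWm : bounded_rv (fun w => \1_W w * m w) by exact: bounded_rvM.
have s3 : Ex P (fun w => (\1_F w - Y w) * (\1_W w * m w)) = 0.
  apply: (Ex_orthogonal sG GO) => //.
  - exact: measurable_funM.
  - exact: integrable_rvMr.
  - exact: (cond_expectation_Ex GO cY).
transitivity (Ex P (fun w => (\1_W w * (\1_F w - Y w)) * z w)
  + Ex P (fun w => (z w - m w) * (\1_W w * Y w))
  - Ex P (fun w => (\1_F w - Y w) * (\1_W w * m w))); last first.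
  by rewrite s1 s2 s3 subr0 addr0.
have i1 : integrable_rv P (fun w => (\1_W w * (\1_F w - Y w)) * z w).
  by apply: integrable_rvMr => //; exact: integrable_rvM.
have i2 : integrable_rv P (fun w => (z w - m w) * (\1_W w * Y w)).
  exact: integrable_rvM.
have i3 : integrable_rv P (fun w => (\1_F w - Y w) * (\1_W w * m w)).
  exact: integrable_rvMr.
rewrite -ExD// -ExB//; last first.
  exact: (@integrableD _ _ _ P setT measurableT (EFin \o _) (EFin \o _)).
by apply: eq_Ex => w; ring.
Qed.

(** The passage from events to functions is made twice, for G and for V: this
    replaces a monotone class argument on the sigma-algebra they generate. *)
Lemma cond_indep_Ex0 (W : set Omega) (b t : Omega -> R) : G W -> W `<=` A ->
  bounded_rv b -> measurable_fun [set: g_sigma_algebraType G] b ->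
  bounded_rv t -> measurable_fun [set: g_sigma_algebraType V] t ->
  Ex P (fun w => \1_W w * (b w * (z w - m w)) * t w) = 0.
Proof.
move=> GW WA bb mb bt mt.
have bzm : bounded_rv (fun w => z w - m w) by exact: bounded_rvB.
have bW : bounded_rv (\1_W : Omega -> R) by apply: bounded_rv_indic; exact: GO.
have bWzm : bounded_rv (fun w => \1_W w * (b w * (z w - m w))).
  by apply: bounded_rvM => //; exact: bounded_rvM.
apply: (Ex_orthogonal sV VO) => //.
- exact: bounded_rv_integrable.
- by apply: bounded_rv_integrable; exact: bounded_rvM.
move=> F VF.
have bF : bounded_rv (\1_F : Omega -> R) by apply: bounded_rv_indic; exact: VO.
rewrite (@eq_Ex _ _ _ _ _ (fun w => (\1_W w * (z w - m w)) * \1_F w * b w)); last first.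
  by move=> w; ring.
have bWF : bounded_rv (fun w => \1_W w * (z w - m w) * \1_F w).
  by apply: bounded_rvM => //; exact: bounded_rvM.
apply: (Ex_orthogonal sG GO) => //.
- exact: bounded_rv_integrable.
- by apply: bounded_rv_integrable; exact: bounded_rvM.
move=> W' GW'.
rewrite (@eq_Ex _ _ _ _ _ (fun w => (\1_(W `&` W') w * (z w - m w)) * \1_F w)); last first.
  by move=> w; rewrite indicI/=; ring.
apply: cond_indep_set => //; first exact: sigma_algebraI2.
by move=> w [/WA].
Qed.

(** In the application t is the sum of the masses of the cubes far from a given
    one, s its conditional mean and b the normalization.  The binomial expansion
    separates the V-measurable powers of t from the G-measurable coefficients. *)
Lemma cond_indep_orthogonal (W : set Omega) (b t s : Omega -> R) (k : nat) :
  G W -> W `<=` A ->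
  bounded_rv b -> measurable_fun [set: g_sigma_algebraType G] b ->
  bounded_rv s -> measurable_fun [set: g_sigma_algebraType G] s ->
  bounded_rv t -> measurable_fun [set: g_sigma_algebraType V] t ->
  Ex P (fun w => \1_W w * ((b w * (z w - m w)) * (b w * (t w - s w)) ^+ k)) = 0.
Proof.
move=> GW WA bb mb bs ms bt mt.
pose c i w := (b w) ^+ k.+1 * (- s w) ^+ i *+ 'C(k, i).
have bc i : bounded_rv (c i).
  rewrite /c; under eq_fun do rewrite -mulr_natr.
  apply: bounded_rvM; last exact: bounded_rv_cst.
  apply: bounded_rvM; apply: bounded_rvX => //.
  exact: bounded_rvN.
have mc i : measurable_fun [set: g_sigma_algebraType G] (c i).
  rewrite /c; under eq_fun do rewrite -mulr_natr.
  apply: measurable_funM => //; apply: measurable_funM; apply: measurable_funX => //.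
  exact: measurable_funN.
have btX i : bounded_rv (fun w => t w ^+ i) by exact: bounded_rvX.
have bzm : bounded_rv (fun w => z w - m w) by exact: bounded_rvB.
have bW : bounded_rv (\1_W : Omega -> R) by apply: bounded_rv_indic; exact: GO.
rewrite (@eq_Ex _ _ _ _ _ (fun w => \sum_(i < k.+1)
    \1_W w * (c i w * (z w - m w)) * t w ^+ (k - i))); last first.
  move=> w; rewrite exprMn exprDn !mulr_sumr; apply: eq_bigr => i _.
  by rewrite /c exprS; move: (t w ^+ (k - i)) ((- s w) ^+ i) 'C(k, i) => T S C; ring.
rewrite Ex_sum; last first.
  move=> i; apply: bounded_rv_integrable; apply: bounded_rvM => //.
  by apply: bounded_rvM => //; exact: bounded_rvM.
rewrite big1// => i _; apply: cond_indep_Ex0 => //.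
exact: measurable_funX.
Qed.

End conditional_independence.

(** * Dyadic cubes *)

Section dyadic_cubes.
Context {R : realType} {M : nat}.
Implicit Types (n N : nat) (x : 'rV[R]_M).

Lemma measurable_fun_coord (i : 'I_M) :
  measurable_fun [set: borelRn R M] (fun x : borelRn R M => (x : 'rV[R]_M) ord0 i).
Proof.
apply: (measurability _ (RGenOpens.measurableE R)).
move=> _ [_ [a [b ->] <-]]; rewrite setTI.
apply: sub_sigma_algebra.
apply: (@open_comp _ _ (fun x : 'rV[R]_M => x ord0 i)) => //.
by move=> x _; exact: coord_continuous.
Qed.

Lemma measurable_dyadic_cube n (k : 'rV[int]_M) :
  measurable (dyadic_cube n k : set (borelRn R M)).
Proof.
rewrite (_ : dyadic_cube n k = \bigcap_(i in [set: 'I_M])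
   (fun x : borelRn R M => (x : 'rV[R]_M) ord0 i) @^-1`
     `[(k ord0 i)%:~R / 2 ^+ n, (k ord0 i + 1)%:~R / 2 ^+ n[%classic); last first.
  apply/seteqP; split => x /= h i; first by move=> _ /=; rewrite in_itv/=; exact: h.
  by have := h i Logic.I; rewrite /= in_itv.
apply: fin_bigcap_measurable => // i _.
by rewrite -[X in measurable X]setTI; exact: measurable_fun_coord.
Qed.

Lemma measurable_euclidean_ball x (r : R) :
  measurable (euclidean_ball x r : set (borelRn R M)).
Proof.
rewrite /euclidean_ball /euclidean_dist.
rewrite (_ : [set y | _] = setT `&` (fun y : borelRn R M =>
   Num.sqrt (\sum_(i < M) (x ord0 i - (y : 'rV[R]_M) ord0 i) ^+ 2)) @^-1` `]-oo, r]%classic); last first.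
  by rewrite setTI; apply/seteqP; split => y /=; rewrite in_itv.
have ms : measurable_fun [set: R] (@Num.sqrt R).
  by apply: continuous_measurable_fun; exact: sqrt_continuous.
have mf : measurable_fun [set: borelRn R M] (fun y : borelRn R M =>
    \sum_(i < M) (x ord0 i - (y : 'rV[R]_M) ord0 i) ^+ 2).
  apply: measurable_sum => i; apply: measurable_funX.
  by apply: measurable_funB => //; exact: measurable_fun_coord.
by apply: (measurableT_comp ms mf) => //; exact: measurable_itv.
Qed.

Lemma dyadic_cube_inj n (k k' : 'rV[int]_M) x :
  dyadic_cube n k x -> dyadic_cube n k' x -> k = k'.
Proof.
move=> h h'; apply/rowP => i.
have /andP[h1 h2] := h i; have /andP[h3 h4] := h' i.
have p0 : 0 < (2 : R)^-1 ^+ n by rewrite exprn_gt0.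
have lt a b : (a%:~R / 2 ^+ n : R) < (b + 1)%:~R / 2 ^+ n -> (a <= b)%R.
  by rewrite ltr_pM2r ?invr_gt0 ?exprn_gt0// ltr_int ltzD1.
apply/eqP; rewrite eq_le (lt _ _ (le_lt_trans h1 h4)).
by rewrite (lt _ _ (le_lt_trans h3 h2)).
Qed.

Definition box N : set 'rV[R]_M := [set x | forall i, - N%:R <= x ord0 i < N%:R].

(** The cubes that tile the box, indexed by a finite type: the shift by
    N * 2 ^ n sends the index 0 to the lower corner of the box. *)
Definition cube_index N n (k : {ffun 'I_M -> 'I_(2 * N * 2 ^ n)}) : 'rV[int]_M :=
  \row_i ((k i)%:Z - (N * 2 ^ n)%:Z).

Lemma cube_index_inj N n : injective (@cube_index N n).
Proof.
move=> k k' /rowP h; apply/ffunP => i; apply: val_inj => /=.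
by have := h i; rewrite !mxE => /addIr[].
Qed.

Lemma dyadic_cube_sub_box N n k : dyadic_cube n (@cube_index N n k) `<=` box N.
Proof.
move=> x h i; have := h i; rewrite mxE => /andP[h1 h2]; apply/andP; split.
  apply: le_trans h1; rewrite ler_pdivlMr ?exprn_gt0//.
  rewrite -natrX mulNr -natrM pmulrn -mulrNz ler_int.
  lia.
apply: (lt_le_trans h2); rewrite ler_pdivrMr ?exprn_gt0//.
rewrite -natrX -natrM pmulrn ler_int; have := ltn_ord (k i).
lia.
Qed.

Lemma box_cover N n x : box N x -> exists k, dyadic_cube n (@cube_index N n k) x.
Proof.
move=> h; have p0 : 0 < (2 : R) ^+ n by rewrite exprn_gt0.
pose z i := Num.floor (x ord0 i * 2 ^+ n).
have z1 i : ((z i)%:~R <= x ord0 i * 2 ^+ n) && (x ord0 i * 2 ^+ n < (z i + 1)%:~R).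
  exact: floor_itv.
have zlt i : (`|(z i + (N * 2 ^ n)%:Z)%R| < 2 * N * 2 ^ n)%N && (0 <= z i + (N * 2 ^ n)%:Z).
  have /andP[a1 a2] := z1 i; have /andP[b1 b2] := h i.
  have c1 : z i < (N * 2 ^ n)%:Z.
    rewrite -(ltr_int R) (le_lt_trans a1)// -pmulrn natrM natrX.
    by rewrite ltr_pM2r.
  have c2 : - (N * 2 ^ n)%:Z <= z i.
    rewrite -ltzD1 -(ltr_int R) (le_lt_trans _ a2)// mulrNz -pmulrn natrM natrX.
    by rewrite -mulNr ler_pM2r.
  lia.
have zlt1 i : (`|(z i + (N * 2 ^ n)%:Z)%R| < 2 * N * 2 ^ n)%N by have /andP[] := zlt i.
exists [ffun i => Ordinal (zlt1 i)] => i; rewrite mxE ffunE /=.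
have -> : Posz `|(z i + (N * 2 ^ n)%:Z)%R|%N - (N * 2 ^ n)%:Z = z i.
  by have /andP[_] := zlt i; lia.
by rewrite ler_pdivrMr// ltr_pdivlMr.
Qed.

(** The radius M.+1 / 2 ^ n, larger than the diameter sqrt M / 2 ^ n, is positive
    also for M = 0, as the Frostman condition requires. *)
Lemma dyadic_cube_sub_ball n (k : 'rV[int]_M) :
  (dyadic_cube n k : set 'rV[R]_M) `<=`
  euclidean_ball (\row_i ((k ord0 i)%:~R / 2 ^+ n)) (M.+1%:R / 2 ^+ n).
Proof.
move=> x h; rewrite /euclidean_ball/= /euclidean_dist.
have p0 : 0 < (2 : R) ^+ n by rewrite exprn_gt0.
have r0 : 0 <= M.+1%:R / 2 ^+ n :> R by rewrite divr_ge0 ?ltW.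
rewrite -[leRHS](ger0_norm r0) -[leRHS]sqrtr_sqr. apply: ler_wsqrtr.
apply: (@le_trans _ _ (\sum_(i < M) (2 ^+ n)^-1 ^+ 2)).
  apply: ler_sum => i _; rewrite mxE.
  have := h i; rewrite intrD mulrDl mul1r => /andP[h1 h2].
  have q0 : 0 <= (2 ^+ n : R)^-1 by rewrite invr_ge0 ltW.
  rewrite -[leLHS]real_normK ?num_real//; apply: lerXn2r; rewrite ?nnegrE//.
  by rewrite ler_norml; apply/andP; split; lra.
rewrite sumr_const card_ord -[leLHS]mulr_natl exprMn; apply: ler_wpM2r; first by rewrite sqr_ge0.
by rewrite -natrX ler_nat; lia.
Qed.

End dyadic_cubes.

(** * Deterministic bounds *)

Section deterministic_bounds.
Context d {Omega : measurableType d} {R : realType} {M : nat}.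
Variables (B : nat -> set (set Omega)) (mu : nat -> Omega -> 'rV[R]_M -> R).
Hypothesis rm : random_measures B mu.

(** Boundedness and bounded support of mu_0 propagate to every mu_n through
    (RM3). *)
Lemma density_bound : exists (C c : R) (N : nat),
  [/\ 1 <= C, 0 <= c,
      forall n w x, mu n.+1 w x <= C * mu n w x,
      forall n w x, mu n w x <= C ^+ n * c &
      forall n w x, ~ box N x -> mu n w x = 0].
Proof.
have mu0 := rm_ge0 rm; have [f [muf [c fc] bf]] := rm1 rm; have [C0 muC0] := rm3 rm.
(* C0 could be negative if mu vanishes. *)
pose C := Num.max 1 C0.
have C1 : 1 <= C by rewrite le_max lexx.
have muC n w x : mu n.+1 w x <= C * mu n w x.
  by rewrite (le_trans (muC0 n w x))// ler_wpM2r// le_max lexx orbT.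
have [b [_ Hb]] := bf.
pose N := (Num.truncn (`|b| + 1)).+1.
exists C, `|c|, N; split => //.
- elim=> [|n ih] w x; first by rewrite expr0 mul1r muf (le_trans (fc x))// ler_norm.
  rewrite (le_trans (muC _ _ _))// exprS -mulrA ler_wpM2l//.
  by rewrite (le_trans _ C1).
have f0 x : ~ box N x -> f x = 0.
  move=> xN; apply/eqP; apply: contra_notT xN => fx0 i.
  have /Hb : b < `|b| + 1 by rewrite (le_lt_trans (ler_norm b))// ltrDl.
  move=> /(_ x fx0) xb.
  have h : `|x ord0 i| < N%:R.
    apply: (@le_lt_trans _ _ (`|b| + 1)).
      apply: le_trans xb; rewrite [leRHS](mx_normrE x).
      by apply/bigmax_geP; right; exists (ord0, i).
    by rewrite -truncn_lt_nat// addr_ge0.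
  by move: h; rewrite ltr_norml => /andP[h1 h2]; rewrite (ltW h1).
elim=> [|n ih] w x xN; first by rewrite muf f0.
apply/eqP; rewrite eq_le mu0 andbT (le_trans (muC _ _ _))//.
by rewrite ih// mulr0.
Qed.

End deterministic_bounds.

Lemma measure_bigsetU_le d (T : measurableType d) (R : realType)
    (nu : {measure set T -> \bar R}) (I : Type) (s : seq I) (F : I -> set T) :
  (forall i, measurable (F i)) ->
  (nu (\big[setU/set0]_(i <- s) F i) <= \sum_(i <- s) nu (F i))%E.
Proof.
move=> mF; elim: s => [|i s ih]; first by rewrite !big_nil measure0.
rewrite !big_cons (le_trans (measureU2 _ _ _))//; last exact: leeD2l.
exact: bigsetU_measurable.
Qed.

Lemma box_bigsetU {R : realType} {M : nat} (N n : nat) :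
  box N = \big[setU/set0]_(k : {ffun 'I_M -> 'I_(2 * N * 2 ^ n)})
    dyadic_cube n (cube_index k) :> set 'rV[R]_M.
Proof.
rewrite -bigcup_seq; apply/seteqP; split => x.
  by move=> /(box_cover n)[k xk]; exists k => //=; rewrite mem_index_enum.
by move=> [k _]; exact: dyadic_cube_sub_box.
Qed.

Section frostman_bounds.
Context {R : realType} {M : nat} {Gamma : Type}.
Variable eta : Gamma -> {measure set (borelRn R M) -> \bar R}.
Variable kappa : R.
Hypothesis hF : frostman_exponent eta kappa.

(** The Frostman condition concerns radii below 1, hence the restriction to small
    cubes. *)
Lemma frostman_dyadic_cube : exists (CF : R) (n0 : nat), 0 < CF /\
  forall n, (n0 <= n)%N -> forall t (k : 'rV[int]_M),
    (eta t (dyadic_cube n k) <= (CF * 2 `^ (- (kappa * n%:R)))%:E)%E.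
Proof.
have [C C0 HC] := hF.
exists (C * M.+1%:R `^ kappa), M.+1; split.
  by rewrite mulr_gt0// powR_gt0.
move=> n n0 t k.
have p0 : 0 < (2 : R) ^+ n by rewrite exprn_gt0.
have r1 : 0 < (M.+1%:R / 2 ^+ n : R) < 1.
  rewrite divr_gt0//= ltr_pdivrMr// mul1r -natrX ltr_nat.
  by rewrite (leq_ltn_trans n0)// ltn_expl.
apply: (@le_trans _ _ (eta t (euclidean_ball
    (\row_i ((k ord0 i)%:~R / 2 ^+ n)) (M.+1%:R / 2 ^+ n)))).
  apply: le_measure; rewrite ?inE.
  - exact: measurable_dyadic_cube.
  - exact: measurable_euclidean_ball.
  - exact: dyadic_cube_sub_ball.
apply: (le_trans (HC t _ _ r1)).
rewrite lee_fin powRM; [|by []|by rewrite invr_ge0 ltW].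
have -> : ((2 ^+ n)^-1 : R) `^ kappa = 2 `^ (- (kappa * n%:R)).
  by rewrite -powR_invn// -powRrM mulNr mulrC.
by rewrite mulrA.
Qed.

(** The box is a finite union of cubes of a fixed small scale, whose masses are
    bounded uniformly in t. *)
Lemma frostman_box (N : nat) :
  exists L : R, forall t, (eta t (box N) <= L%:E)%E.
Proof.
have [CF [n [CF0 Hn]]] := frostman_dyadic_cube.
pose K := {ffun 'I_M -> 'I_(2 * N * 2 ^ n)}.
exists (\sum_(k : K) CF * 2 `^ (- (kappa * n%:R))).
move=> t.
rewrite (box_bigsetU N n) -sumEFin.
apply: (le_trans (measure_bigsetU_le _ _ _)).
  by move=> k; exact: measurable_dyadic_cube.
by apply: lee_sum => k _; exact: Hn.
Qed.

End frostman_bounds.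

(** * Masses of subsets of the box *)

Section measurable_indic_prod.
Context d1 d2 {T1 : measurableType d1} {T2 : measurableType d2} {R : realType}.
Implicit Types f : T1 * T2 -> R.

Lemma measurable_indic_fstM (A : set T1) f : measurable A ->
  measurable_fun setT f -> measurable_fun setT (fun x => \1_A x.1 * f x).
Proof.
move=> mA mf; apply: measurable_funM => //.
have mI : measurable_fun setT (\1_A : T1 -> R) by exact: measurable_indic.
suff : measurable_fun [set: T1 * T2] ((\1_A : T1 -> R) \o fst) by [].
exact: measurableT_comp.
Qed.

Lemma measurable_indic_sndM (A : set T2) f : measurable A ->
  measurable_fun setT f -> measurable_fun setT (fun x => \1_A x.2 * f x).
Proof.
move=> mA mf; apply: measurable_funM => //.
have mI : measurable_fun setT (\1_A : T2 -> R) by exact: measurable_indic.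
suff : measurable_fun [set: T1 * T2] ((\1_A : T2 -> R) \o snd) by [].
exact: measurableT_comp.
Qed.

End measurable_indic_prod.

Section masses.
Context d {Omega : measurableType d} {R : realType} {M : nat}.
Variables (P : probability Omega R) (B : nat -> set (set Omega)).
Variable mu : nat -> Omega -> 'rV[R]_M -> R.
Hypothesis rm : random_measures B mu.
Context {Gamma : Type}.
Variable eta : Gamma -> {measure set (borelRn R M) -> \bar R}.
Variables (C c L : R) (N : nat).
Hypothesis C1 : 1 <= C.
Hypothesis c0 : 0 <= c.
Hypothesis muC : forall n w x, mu n.+1 w x <= C * mu n w x.
Hypothesis mu_le : forall n w x, mu n w x <= C ^+ n * c.
Hypothesis mu_supp : forall n w x, ~ box N x -> mu n w x = 0.
Hypothesis etaL : forall t, (eta t (box N) <= L%:E)%E.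

Let mu0 := rm_ge0 rm.

Lemma measurable_density n w :
  measurable_fun [set: borelRn R M] (mu n w : borelRn R M -> R).
Proof.
have h := @measurable_fun_pair2 _ _ _ (g_sigma_algebraType (B n)) (borelRn R M) R
  (fun wx => mu n wx.1 wx.2) w (rm2 rm (n := n)).
exact: h.
Qed.

Lemma measurable_density_pair n :
  measurable_fun [set: Omega * borelRn R M] (fun wx => mu n wx.1 wx.2).
Proof.
have [sB BO _] := rm2_filtration rm.
have mid : measurable_fun [set: Omega * borelRn R M]
    (fun wx => (wx.1 : g_sigma_algebraType (B n), wx.2)).
  apply: measurable_fun_pair => //.
  move=> _ A; rewrite /measurable/= (sigma_algebra_id (sB n)) => /BO mA.
  by rewrite setTI; have := @measurable_fst _ _ Omega (borelRn R M) measurableT _ mA;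
    rewrite setTI.
exact: (measurableT_comp (rm2 rm (n := n)) mid).
Qed.

Lemma measurable_box : measurable (box N : set (borelRn R M)).
Proof.
rewrite (box_bigsetU N 0); apply: bigsetU_measurable => k _.
exact: measurable_dyadic_cube.
Qed.

Section one_set.
Variables (D : set (borelRn R M)) (mD : measurable D) (DN : D `<=` box N).

Let etaD t : (eta t D <= L%:E)%E.
Proof.
by apply: le_trans (etaL t); apply: le_measure => //; rewrite inE//; exact: measurable_box.
Qed.

Let etaDoo t : (eta t D < +oo)%E.
Proof. by rewrite (le_lt_trans (etaD t))// ltry. Qed.

Lemma integrable_density n t w : (eta t).-integrable D (EFin \o mu n w).
Proof.
apply: measurable_bounded_integrable => //.
  exact: measurable_funTS (measurable_density n w).
exists (C ^+ n * c); split; first exact: num_real.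
by move=> y Cy x _ /=; rewrite ger0_norm ?mu0// (le_trans (mu_le _ _ _)) ?ltW.
Qed.

Lemma intersection_massE n t w :
  ((intersection_mass mu eta n t D w)%:E = \int[eta t]_(x in D) (mu n w x)%:E)%E.
Proof.
rewrite /intersection_mass /Rintegral fineK//.
by apply: (integrable_fin_num mD (integrable_density n t w)).
Qed.

Lemma intersection_mass_ge0 n t w : 0 <= intersection_mass mu eta n t D w.
Proof. by apply: Rintegral_ge0. Qed.

Lemma intersection_mass_le_measure n t w (a : R) : (forall x, mu n w x <= a) ->
  intersection_mass mu eta n t D w <= a * fine (eta t D).
Proof.
move=> mua.
rewrite -(Rintegral_cst (eta t) mD a)//.
apply: le_Rintegral => //; first exact: integrable_density.
by apply: measurable_bounded_integrable => //; exact: bounded_cst.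
Qed.

Lemma intersection_mass_le n t w :
  intersection_mass mu eta n t D w <= C ^+ n * c * L.
Proof.
rewrite (le_trans (intersection_mass_le_measure t (mu_le n w)))//.
have Cn : 0 <= C ^+ n * c by rewrite mulr_ge0// exprn_ge0// (le_trans _ C1).
by rewrite ler_wpM2l// -lee_fin fineK// ge0_fin_numE.
Qed.

Lemma intersection_mass_step n t w :
  intersection_mass mu eta n.+1 t D w <= C * intersection_mass mu eta n t D w.
Proof.
rewrite /intersection_mass -RintegralZl//; last exact: integrable_density.
apply: le_Rintegral => //; first exact: integrable_density.
exact: (integrableZl mD C (integrable_density n t w)).
Qed.

(** Tonelli's theorem asks for a sigma-finite measure; this restriction of eta t
    is finite, and integrals over D do not see the difference. *)
Let beta t : {finite_measure set (borelRn R M) -> \bar R} := mfrestr mD (etaDoo t).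

Let integral_beta t (f : borelRn R M -> \bar R) :
  (\int[eta t]_(x in D) f x = \int[beta t]_x (f \_ D) x)%E.
Proof.
rewrite -integral_mkcond; apply: eq_measure_integral => A mA AD.
by rewrite /beta/= /mfrestr /mrestr setIidl.
Qed.

Lemma measurable_intersection_mass n t :
  measurable_fun [set: g_sigma_algebraType (B n)] (intersection_mass mu eta n t D).
Proof.
apply/measurable_EFinP.
have -> : EFin \o intersection_mass mu eta n t D =
    fubini_F (beta t) (fun wx : g_sigma_algebraType (B n) * borelRn R M =>
      (\1_D wx.2 * mu n wx.1 wx.2)%:E).
  apply/funext => w; rewrite /= intersection_massE integral_beta /fubini_F/=.
  apply: eq_integral => x _; rewrite patchE indicE.
  by case: (x \in D); rewrite ?mul1r ?mul0r.
apply: measurable_fun_fubini_tonelli_F => /=.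
  apply/measurable_EFinP.
  exact: (measurable_indic_sndM mD (rm2 rm (n := n))).
by move=> wx; rewrite lee_fin mulr_ge0.
Qed.

Lemma bounded_intersection_mass n t :
  bounded_rv (intersection_mass mu eta n t D).
Proof.
have [sB BO _] := rm2_filtration rm.
split.
  apply: (sub_measurable_fun (sB n) (BO n)); exact: measurable_intersection_mass.
exists (C ^+ n * c * L) => w; rewrite ger0_norm ?intersection_mass_ge0//.
exact: intersection_mass_le.
Qed.

Lemma integral_intersection_mass n t (A : set Omega) : measurable A ->
  (\int[P]_(w in A) (intersection_mass mu eta n t D w)%:E =
   \int[beta t]_x ((fun x => \int[P]_(w in A) (mu n w x)%:E) \_ D) x)%E.
Proof.
move=> mA.
pose f (wx : Omega * borelRn R M) := (\1_A wx.1 * (\1_D wx.2 * mu n wx.1 wx.2))%:E.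
have mf : measurable_fun setT f.
  apply/measurable_EFinP; apply: (measurable_indic_fstM mA).
  exact: (measurable_indic_sndM mD (measurable_density_pair n)).
have f0 wx : (0 <= f wx)%E by rewrite lee_fin !mulr_ge0.
transitivity (\int[P]_w \int[beta t]_x f (w, x))%E.
  rewrite integral_mkcond; apply: eq_integral => w _; rewrite patchE /f/= indicE.
  case: (w \in A); last first.
    by under eq_integral do rewrite mul0r; rewrite integral0.
  rewrite intersection_massE integral_beta.
  apply: eq_integral => x _; rewrite patchE indicE mul1r.
  by case: (x \in D); rewrite ?mul1r ?mul0r.
rewrite (@fubini_tonelli _ _ _ _ _ P (beta t) f mf f0).
apply: eq_integral => x _; rewrite patchE /f/= indicE.
case: (x \in D); last first.
  by under eq_integral do rewrite mul0r mulr0; rewrite integral0.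
rewrite [RHS]integral_mkcond; apply: eq_integral => w _; rewrite patchE indicE mul1r.
by case: (w \in A); rewrite ?mul1r ?mul0r.
Qed.

(** By Tonelli's theorem the martingale property, which holds at every point x,
    can be integrated over D. *)
Lemma intersection_mass_martingale n t : martingale_measure P B mu ->
  is_cond_expectation P (B n) (intersection_mass mu eta n.+1 t D)
                              (intersection_mass mu eta n t D).
Proof.
move=> [_ mart]; have [sB BO _] := rm2_filtration rm.
split.
- exact/bounded_rv_integrable/bounded_intersection_mass.
- exact/bounded_rv_integrable/bounded_intersection_mass.
- exact: measurable_intersection_mass.
move=> A BA; have mA := BO _ _ BA.
rewrite !integral_intersection_mass//; apply: eq_integral => x _.
rewrite !patchE; case: (x \in D) => //.
by have [_ _ _ ->] := mart n x.
Qed.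

End one_set.

Lemma total_mass_box n t w :
  total_mass mu eta n t w = intersection_mass mu eta n t (box N) w.
Proof.
rewrite /total_mass /intersection_mass [RHS]Rintegral_mkcond; apply: eq_Rintegral => x _.
rewrite patchE; case: (boolP (x \in box N)) => //.
by rewrite notin_setE => /mu_supp ->.
Qed.

Lemma total_mass_sum_cubes m n t w : total_mass mu eta n t w =
  \sum_(k : {ffun 'I_M -> 'I_(2 * N * 2 ^ m)})
     intersection_mass mu eta n t (dyadic_cube m (cube_index k)) w.
Proof.
apply: EFin_inj; rewrite total_mass_box.
rewrite (intersection_massE measurable_box (@subset_refl _ _)).
rewrite (box_bigsetU N m) integral_bigsetU_EFin//; first last.
- by apply/measurable_EFinP; apply: measurable_funTS; exact: measurable_density.
- move=> k k' _ _ [x [kx kx']]; apply: (@cube_index_inj M N m).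
  exact: dyadic_cube_inj kx kx'.
- exact: index_enum_uniq.
- by move=> k; exact: measurable_dyadic_cube.
rewrite -sumEFin; apply: eq_bigr => k _.
rewrite intersection_massE//; first exact: measurable_dyadic_cube.
exact: dyadic_cube_sub_box.
Qed.

End masses.

(** * Tail of one increment *)

Section sigma_family.
Context d {Omega : measurableType d} {R : realType} {I : Type}.
Variables (X : I -> Omega -> R) (J : set I).

Lemma sigma_algebra_sigma_family : sigma_algebra setT (sigma_family X J).
Proof. exact: smallest_sigma_algebra. Qed.

Lemma sigma_family_sub : (forall j, J j -> measurable_fun setT (X j)) ->
  sigma_family X J `<=` measurable.
Proof.
move=> mX; apply: smallest_sub; first exact: sigma_algebra_measurable.
by move=> A [j Jj [Y mY <-]]; exact: mX.
Qed.

Lemma measurable_sigma_family j : J j ->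
  measurable_fun [set: g_sigma_algebraType (sigma_family X J)] (X j).
Proof.
move=> Jj _ Y mY; apply: sub_sigma_algebra; apply: sub_sigma_algebra.
by exists j => //; exists Y.
Qed.

End sigma_family.

Lemma measurable_sum_in d (T : measurableType d) (R : realType) (I : Type)
    (s : seq I) (Q : pred I) (f : I -> T -> R) :
  (forall i, Q i -> measurable_fun setT (f i)) ->
  measurable_fun setT (fun x => \sum_(i <- s | Q i) f i x).
Proof.
move=> mf; elim: s => [|i s ih].
  by under eq_fun do rewrite big_nil; exact: measurable_cst.
under eq_fun do rewrite big_cons.
case: (boolP (Q i)) => // Qi; apply: measurable_funD => //; exact: mf.
Qed.

Lemma card_le_finset (T : Type) (I : finType) (f : I -> T) (F : {set I})
    (S : set T) (k : nat) : injective f -> (forall i, i \in F -> S (f i)) ->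
  (S #<= `I_k)%card -> (#|F| <= k)%N.
Proof.
move=> injf FS /pcard_leP[g].
have gk i : i \in F -> (g (f i) < k)%N.
  by move=> /FS Sfi; have /= := @funS _ _ _ _ g _ Sfi.
case: k g gk => [|k] g gk.
  rewrite leqn0 cards_eq0; apply/eqP/setP => i; rewrite inE.
  by apply/negP => /gk.
rewrite -[leqRHS]card_ord.
have inj : {in F &, injective (fun i => inord (g (f i)) : 'I_k.+1)}.
  move=> i j Fi Fj /(congr1 val); rewrite /= !inordK ?gk// => gij.
  by apply: injf; apply: (@inj _ _ _ g) => //; rewrite inE; exact: FS.
by rewrite -(card_in_imset inj) max_card.
Qed.

Section increment_tail.
Context d {Omega : measurableType d} {R : realType} {M : nat}.
Variables (P : probability Omega R) (B : nat -> set (set Omega)).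
Variable mu : nat -> Omega -> 'rV[R]_M -> R.
Hypothesis mart : martingale_measure P B mu.
Context {Gamma : Type}.
Variable eta : Gamma -> {measure set (borelRn R M) -> \bar R}.
Variables (C c L : R) (N : nat).
Hypothesis C1 : 1 <= C.
Hypothesis c0 : 0 <= c.
Hypothesis muC : forall n w x, mu n.+1 w x <= C * mu n w x.
Hypothesis mu_le : forall n w x, mu n w x <= C ^+ n * c.
Hypothesis mu_supp : forall n w x, ~ box N x -> mu n w x = 0.
Hypothesis etaL : forall t, (eta t (box N) <= L%:E)%E.

Let rm : random_measures B mu := mart.1.

Variables (n : nat) (t : Gamma) (Ev : set Omega) (D : nat) (Psi : Omega -> nat).
Variable E : Omega -> 'rV[int]_M -> 'rV[int]_M -> Prop.
Hypothesis depE : cond_dependency_graph P (B n)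
  (fun k => intersection_mass mu eta n.+1 t (dyadic_cube n.+1 k)) E.
Hypothesis degE : {ae P, forall w, max_degree_le (E w) (Psi w)}.
Hypothesis BEv : B n Ev.
Hypothesis EvPsi : forall w, Ev w -> (Psi w <= D)%N.
Variables a q : R.
Hypothesis a0 : 0 <= a.
Hypothesis q0 : 0 <= q.
Hypothesis mua : {ae P, forall w, forall x, mu n w x <= a}.
Hypothesis etaq : forall k : 'rV[int]_M, (eta t (dyadic_cube n.+1 k) <= q%:E)%E.

Local Notation I := {ffun 'I_M -> 'I_(2 * N * 2 ^ n.+1)}.
Let ix (i : I) : 'rV[int]_M := cube_index i.
Let Z (i : I) := intersection_mass mu eta n.+1 t (dyadic_cube n.+1 (ix i)).
Let m (i : I) := intersection_mass mu eta n t (dyadic_cube n.+1 (ix i)).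
Let Y := total_mass mu eta n t.
Let Y' := total_mass mu eta n.+1 t.
(** The B_n-measurable normalization 1 / (1 + Y) turns the random bound
    (C + 1) Y on the sum of the absolute values of the differences Z - m into
    the deterministic bound C + 1. *)
Let h w := (1 + Y w)^-1.
Let X i w := h w * (Z i w - m i w).
(** The closed neighbourhood: it contains i, so that the far sum of i does not
    involve X i. *)
Let nbr w i : {set I} := [set j | (j == i) || `[< E w (ix i) (ix j) >]].

Let sB : sigma_algebra setT (B n). Proof. by have [] := rm2_filtration rm. Qed.
Let BO : B n `<=` measurable. Proof. by have [_ + _] := rm2_filtration rm; exact. Qed.

Let mcube (i : I) : measurable (dyadic_cube n.+1 (ix i) : set (borelRn R M)).
Proof. exact: measurable_dyadic_cube. Qed.
Let cubeN (i : I) : (dyadic_cube n.+1 (ix i) : set (borelRn R M)) `<=` box N.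
Proof. exact: dyadic_cube_sub_box. Qed.

Let bZ i : bounded_rv (Z i). Proof. exact: (bounded_intersection_mass rm C1 c0 mu_le etaL). Qed.
Let bm i : bounded_rv (m i). Proof. exact: (bounded_intersection_mass rm C1 c0 mu_le etaL). Qed.
Let mm i : measurable_fun [set: g_sigma_algebraType (B n)] (m i).
Proof. exact: (measurable_intersection_mass rm mu_le etaL). Qed.
Let m0 i w : 0 <= m i w. Proof. exact: (intersection_mass_ge0 rm). Qed.
Let Z0 i w : 0 <= Z i w. Proof. exact: (intersection_mass_ge0 rm). Qed.
Let Zm i w : Z i w <= C * m i w.
Proof. exact: (intersection_mass_step rm muC mu_le etaL). Qed.

Let YE w : Y w = \sum_i m i w.
Proof. exact: (total_mass_sum_cubes rm mu_le mu_supp etaL). Qed.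
Let YE' w : Y' w = \sum_i Z i w.
Proof. exact: (total_mass_sum_cubes rm mu_le mu_supp etaL). Qed.

Let Y0 w : 0 <= Y w. Proof. by rewrite YE sumr_ge0. Qed.

Let mY : measurable_fun [set: g_sigma_algebraType (B n)] Y.
Proof. by rewrite (funext YE); exact: measurable_sum. Qed.

Let bY : bounded_rv Y. Proof. by rewrite (funext YE); exact: bounded_rv_sum. Qed.

Let h_gt0 w : 0 < h w. Proof. by rewrite invr_gt0 ltr_pwDl. Qed.
Let h_le1 w : h w <= 1. Proof. by rewrite invf_le1 ?ltr_pwDl// lerDl. Qed.

Let mh : measurable_fun [set: g_sigma_algebraType (B n)] h.
Proof.
rewrite /h (_ : (fun w => _) = (fun w => (1 + Y w) `^ (-1))); last first.
  by apply/funext => w; rewrite powR_inv1// addr_ge0.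
suff : measurable_fun [set: g_sigma_algebraType (B n)]
  ((fun x : R => x `^ (-1)) \o (fun w => 1 + Y w)) by [].
apply: measurableT_comp; first exact: measurable_powR.
by apply: measurable_funD.
Qed.

Let bh : bounded_rv h.
Proof.
split; first exact: (sub_measurable_fun sB BO).
by exists 1 => w; rewrite ger0_norm//; exact: ltW.
Qed.

Let bX i : bounded_rv (X i).
Proof. by apply: bounded_rvM => //; exact: bounded_rvB. Qed.

Let nbrB i (J : {set I}) : B n [set w | nbr w i = J].
Proof.
have [_ BE _] := depE.
rewrite (_ : [set w | _] = \bigcap_(j in [set: I]) [set w | (j \in nbr w i) = (j \in J)]); last first.
  apply/seteqP; split => [w /= <- //|w /= e]; apply/setP => j; exact: e.
rewrite -[B n](sigma_algebra_id sB).
apply: (@fin_bigcap_measurable _ (g_sigma_algebraType (B n))) => // j _.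
have mE : measurable (([set w | E w (ix i) (ix j)]) : set (g_sigma_algebraType (B n))).
  exact: sub_sigma_algebra.
case: (eqVneq j i) => [->|ji].
  rewrite (_ : [set w | _] = [set w | (i \in J)]); last first.
    by apply/seteqP; split => w /=; rewrite inE eqxx/=.
  case: (i \in J).
    by rewrite (_ : [set _ | _] = setT)//; apply/seteqP; split.
  by rewrite (_ : [set _ | _] = set0)//; apply/seteqP; split.
case: (boolP (j \in J)) => jJ.
  rewrite (_ : [set w | _] = [set w | E w (ix i) (ix j)])//.
  apply/seteqP; split => w /=; rewrite inE (negbTE ji)/=.
    by move=> /asboolP.
  by move=> Ew; apply/asboolP.
rewrite (_ : [set w | _] = ~` [set w | E w (ix i) (ix j)]); first exact: measurableC.
apply/seteqP; split => w /=; rewrite inE (negbTE ji)/=.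
  by move=> /negbT/asboolPn.
by move=> Ew; apply/negbTE/asboolPn.
Qed.

(** The degree bound and the bound on the masses hold almost surely on Ev.  The
    restriction to A makes them hold everywhere, at no cost in probability, and
    keeps the event B_n-measurable. *)
Let A := Ev `&` ([set w | forall i, (#|nbr w i| <= D.+1)%N] `&`
                 [set w | forall i, m i w <= a * q]).

Let BA : B n A.
Proof.
rewrite -[B n](sigma_algebra_id sB).
apply: (@measurableI _ (g_sigma_algebraType (B n))); first exact: sub_sigma_algebra.
apply: (@measurableI _ (g_sigma_algebraType (B n))).
  rewrite (_ : [set w | _] = \bigcap_(i in [set: I])
      \bigcup_(J in [set J : {set I} | (#|J| <= D.+1)%N]) [set w | nbr w i = J]); last first.
    apply/seteqP; split => [w /= hw i _|w /= hw i]; first by exists (nbr w i) => //=.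
    by have [//|J /= JD ->] := hw i.
  apply: (@fin_bigcap_measurable _ (g_sigma_algebraType (B n))) => // i _.
  apply: (@fin_bigcup_measurable _ (g_sigma_algebraType (B n))) => // J _.
  exact: sub_sigma_algebra.
rewrite (_ : [set w | _] = \bigcap_(i in [set: I]) (m i @^-1` `]-oo, (a * q)])); last first.
  apply/seteqP; split => [w /= hw i _|w /= hw i]; first by rewrite /= in_itv/=.
  by have := hw i Logic.I; rewrite /= in_itv.
apply: (@fin_bigcap_measurable _ (g_sigma_algebraType (B n))) => // i _.
by rewrite -[X in measurable X]setTI; apply: mm => //; exact: measurable_itv.
Qed.

Let ix_inj : injective ix. Proof. exact: cube_index_inj. Qed.

Let aeA : {ae P, forall w, Ev w -> A w}.
Proof.
apply: filterS2 degE mua => w degw muw Evw; split => //; split => i /=.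
  rewrite (cardsD1 i) inE eqxx add1n ltnS (leq_trans _ (EvPsi Evw))//.
  apply: (@card_le_finset _ _ ix _ [set j | E w (ix i) j]) => //.
  by move=> j; rewrite !inE => /andP[/negbTE ->] /= /asboolP.
rewrite (le_trans (intersection_mass_le_measure rm mu_le etaL (mcube i) (@cubeN i) t muw))//.
rewrite ler_wpM2l// -lee_fin fineK; first exact: etaq.
by rewrite ge0_fin_numE// (le_lt_trans (etaq _))// ltry.
Qed.

(** Where the neighbourhood of i is J, the graph has no edge from i to an index
    outside J, and conditional independence applies. *)
Let orthoX i (J : {set I}) k :
  Ex P (fun w => \1_(A `&` [set w | nbr w i = J]) w *
                 (X i w * (\sum_(j | j \notin J) X j w) ^+ k)) = 0.
Proof.
case: (boolP (i \in J)) => iJ; last first.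
  rewrite (@eq_Ex _ _ _ _ _ (fun=> 0)); first by rewrite /Ex Rintegral_cst// mul0r.
  move=> w; rewrite indicE memNset ?mul0r//= => -[_ Ji].
  by move: iJ; rewrite -Ji inE eqxx.
have [_ _ indep] := depE.
pose Zf k := intersection_mass mu eta n.+1 t (dyadic_cube n.+1 k).
pose far := ix @` [set j | j \notin J].
have nfar : ~ far (ix i) by move=> [j /= jJ /ix_inj ji]; rewrite ji iJ in jJ.
have := indep (ix i) far nfar; rewrite -/Zf => ind.
have mart_i := intersection_mass_martingale rm C1 c0 mu_le etaL (mcube i) (@cubeN i) n t mart.
pose s w := \sum_(j | j \notin J) m j w.
pose z w := \sum_(j | j \notin J) Z j w.
have := @cond_indep_orthogonal _ _ _ P (B n) (sigma_family Zf [set ix i]) (sigma_family Zf far)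
  sB BO (@sigma_algebra_sigma_family _ _ _ _ _ _) _
  (@sigma_algebra_sigma_family _ _ _ _ _ _) _ _ ind (Z i) (m i) (bZ i) _ mart_i (bm i)
  (A `&` [set w | nbr w i = J]) h z s k.
have -> : (fun w => \1_(A `&` [set w | nbr w i = J]) w *
                 (X i w * (\sum_(j | j \notin J) X j w) ^+ k)) =
  (fun w => \1_(A `&` [set w0 | nbr w0 i = J]) w *
      (h w * (Z i w - m i w) * (h w * (z w - s w)) ^+ k)).
  apply/funext => w; congr (_ * (_ * _ ^+ _)).
  by rewrite /z /s -sumrB mulr_sumr.
apply => //.
- by apply: sigma_family_sub => _ ->; exact: (bZ i).1.
- by apply: sigma_family_sub => _ [j _ <-]; exact: (bZ j).1.
- exact: measurable_sigma_family.
- exact: sigma_algebraI2.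
- move=> w [_ /= nJ] _ [j /= jJ <-] Ej.
  move: jJ; rewrite -nJ inE negb_or => /andP[_ /asboolP]; exact.
- exact: bounded_rv_sum.
- by apply: measurable_sum_in => j _; exact: mm.
- exact: bounded_rv_sum.
- apply: measurable_sum_in => j jJ.
  by apply: (@measurable_sigma_family _ _ _ _ Zf far (ix j)); exists j.
Qed.

Let XS w : \sum_i X i w = h w * (Y' w - Y w).
Proof. by rewrite YE YE' -sumrB mulr_sumr. Qed.

Let X_le i w : `|X i w| <= h w * ((C + 1) * m i w).
Proof.
rewrite normrM (ger0_norm (ltW (h_gt0 w))) ler_wpM2l//; first exact: ltW.
rewrite (le_trans (ler_normB _ _))// !ger0_norm// mulrDl mul1r lerD2r.
exact: Zm.
Qed.

(** Markov's inequality for the moment of order 2 p of the normalized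
    increment. *)
Lemma increment_tail (p : nat) (e : R) (Delta := D.+1%:R * ((C + 1) * (a * q))) :
  0 < e ->
  (P (Ev `&` [set w | (e * (1 + total_mass mu eta n t w) <
                      `|total_mass mu eta n.+1 t w - total_mass mu eta n t w|)%R]) <=
   ((moment_const p)%:R * ((C + 1) * Delta + Delta ^+ 2) ^+ p / e ^+ (2 * p))%:E)%E.
Proof.
move=> e0.
pose T := [set w | e < `|\sum_i X i w|].
have bS : bounded_rv (fun w => \sum_i X i w) by exact: bounded_rv_sum.
have mT : measurable T.
  rewrite (_ : T = setT `&` (fun w => `|\sum_i X i w|) @^-1` `]e, +oo[%classic).
    by apply: (bounded_rv_norm bS).1 => //; exact: measurable_itv.
  by rewrite setTI; apply/seteqP; split => w /=; rewrite in_itv/= andbT.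
have -> : [set w | e * (1 + total_mass mu eta n t w) <
    `|total_mass mu eta n.+1 t w - total_mass mu eta n t w|] = T.
  apply/seteqP; split => w; rewrite /T/= XS normrM (ger0_norm (ltW (h_gt0 w)));
    by rewrite /h [_^-1 * _]mulrC ltr_pdivlMr ?ltr_pwDl.
have mEv : measurable Ev by exact: BO.
have mA : measurable A by exact: BO.
rewrite -Ex_indic; last exact: measurableI.
have bAT : bounded_rv (\1_(A `&` T) : Omega -> R).
  by apply: bounded_rv_indic; exact: measurableI.
have bEvT : bounded_rv (\1_(Ev `&` T) : Omega -> R).
  by apply: bounded_rv_indic; exact: measurableI.
have -> : Ex P \1_(Ev `&` T) = Ex P \1_(A `&` T).
  apply: Ex_ae_eq; first exact: bounded_rv_integrable.
    exact: bAT.1.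
  apply: filterS aeA => w EvA; rewrite !indicE; congr (_ %:R); congr nat_of_bool.
  by apply/idP/idP; rewrite !inE/= => -[Aw Tw]; split => //; [exact: EvA|case: Aw].
have Dl0 : 0 <= C + 1 by rewrite addr_ge0// (le_trans _ C1).
have aq0 : 0 <= a * q by rewrite mulr_ge0.
have mb := @moment_bound _ _ _ P _ X nbr A D.+1 ((C + 1) * (a * q)) (C + 1)
  bX (fun i J => BO (nbrB i J)) mA orthoX (fun w Aw => Aw.2.1)
  (mulr_ge0 Dl0 aq0) Dl0 _ _ p.
rewrite lee_fin ler_pdivlMr ?exprn_gt0// (le_trans _ (mb _ _))//; last 2 first.
- move=> w [_ [_ mw]] i; rewrite (le_trans (X_le i w))// -[leRHS]mul1r.
  apply: ler_pM => //; [exact: ltW|by rewrite mulr_ge0|].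
  by rewrite ler_wpM2l//; exact: mw.
- move=> w _; rewrite (le_trans (ler_sum _ (fun i _ => X_le i w)))//.
  rewrite -mulr_sumr -mulr_sumr -YE mulrCA -[leRHS]mulr1 ler_wpM2l//.
  by rewrite /h mulrC ler_pdivrMr ?ltr_pwDl// mul1r lerDr.
have bSp : bounded_rv (fun w => \1_A w * (\sum_i X i w) ^+ (2 * p)).
  by apply: bounded_rvM; [exact: bounded_rv_indic|exact: bounded_rvX].
rewrite mulrC -ExZ; last exact: bounded_rv_integrable.
apply: Ex_le => [||w].
- by apply: bounded_rv_integrable; apply: bounded_rvM => //; exact: bounded_rv_cst.
- exact: bounded_rv_integrable.
rewrite indicI/= !indicE; case: (w \in A); last by rewrite !mul0r mulr0.
rewrite !mul1r; case: (boolP (w \in T)) => wT; last first.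
  by rewrite mulr0 exprM exprn_ge0// sqr_ge0.
move: wT; rewrite inE /T/= mulr1 => /ltW eS.
rewrite !exprM -[(\sum_i X i w) ^+ 2]real_normK ?num_real//.
by rewrite !lerXn2r ?nnegrE ?sqr_ge0// ltW.
Qed.

End increment_tail.

(** * Paths with geometrically small increments on nets *)

Section geometric_increments.
Context {R : realType}.
Variables (rho K : R) (u : nat -> R).
Hypothesis rho01 : 0 < rho < 1.
Hypothesis u_step : forall n, `|u n.+1 - u n| <= K * rho ^+ n.

(** With c = K / (1 - rho), the sequence u n - c rho^n increases, u n + c rho^n
    decreases, and their difference tends to zero: the limit lies between. *)
Lemma geometric_increment_cvg n : `|u n - limn u| <= K / (1 - rho) * rho ^+ n.
Proof.
have /andP[r0 r1] := rho01.
have r1' : 0 < 1 - rho by rewrite subr_gt0.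
pose c := K / (1 - rho).
have cE : c * (1 - rho) = K by rewrite /c -mulrA mulVf ?mulr1// gt_eqF.
have K0 : 0 <= K.
  by have := le_trans (normr_ge0 _) (u_step 0%N); rewrite expr0 mulr1.
have c0 : 0 <= c by rewrite divr_ge0// ltW.
pose lo n := u n - c * rho ^+ n; pose hi n := u n + c * rho ^+ n.
have rstep k : c * rho ^+ k - c * rho ^+ k.+1 = K * rho ^+ k.
  by rewrite -cE exprS; ring.
have ndlo : nondecreasing_seq lo.
  apply/nondecreasing_seqP => k; rewrite /lo.
  by have := u_step k; rewrite -rstep ler_norml => /andP[h _]; lra.
have nihi : nonincreasing_seq hi.
  apply/nonincreasing_seqP => k; rewrite /hi.
  by have := u_step k; rewrite -rstep ler_norml => /andP[_ h]; lra.
have lohi k : lo k <= hi k.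
  by have := mulr_ge0 c0 (exprn_ge0 k (ltW r0)); rewrite /lo /hi; lra.
have cvlo : cvgn lo.
  apply: nondecreasing_is_cvgn => //; exists (hi 0%N) => _ [k _ <-].
  by rewrite (le_trans (lohi k))// nihi.
have cr : (fun n => c * rho ^+ n) @ \oo --> (0 : R).
  rewrite -[0](mulr0 c); apply: cvgMr; apply: cvg_expr.
  by rewrite ger0_norm// ltW.
have cu : u @ \oo --> limn lo.
  rewrite (_ : u = lo \+ (fun n => c * rho ^+ n)); last first.
    by apply/funext => k; rewrite /lo/= subrK.
  by rewrite -[X in _ --> X]addr0; apply: cvgD.
have chi : hi @ \oo --> limn lo.
  by rewrite -[X in _ --> X]addr0; apply: cvgD.
rewrite (cvg_lim _ cu)// ler_norml -/c.
have h1 := nondecreasing_cvgn_le ndlo cvlo n.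
have h2 : limn lo <= hi n.
  have := nonincreasing_cvgn_ge nihi (cvgP _ chi) n.
  by rewrite (cvg_lim _ chi).
by move: h1 h2; rewrite /lo /hi => h1 h2; apply/andP; split; lra.
Qed.

End geometric_increments.

Section pathwise.
Context {R : realType} (Gamma : metricType R).
Variables (y : nat -> Gamma -> R) (L : nat -> R) (net : nat -> seq Gamma).
Variables (lambda theta gamma0 H : R) (K : nat).
Let a := (theta + lambda) / gamma0.
Hypothesis lambda_gt0 : 0 < lambda.
Hypothesis theta_gt0 : 0 < theta.
Hypothesis gamma0_gt0 : 0 < gamma0.
Hypothesis H0 : 0 <= H.
Hypothesis y0 : forall n t, 0 <= y n t.
Hypothesis yL : forall n t, y n t <= L n.
Hypothesis netP : forall n u,
  exists2 t, t \in net n & mdist t u <= 2 `^ (- (a * n%:R)).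
Hypothesis y_hoelder : forall n t u, (K <= n)%N ->
  `|y n t - y n u| <= H * (2 `^ (theta * n%:R) * mdist t u `^ gamma0).
Hypothesis y_net : forall n t, (K <= n)%N -> t \in net n ->
  `|y n.+1 t - y n t| <= 2 `^ (- lambda * n%:R) * (1 + y n t).

Let rho : R := 2 `^ (- lambda).

Let pow2_gt0 (x : R) : 0 < (2 : R) `^ x. Proof. exact: powR_gt0. Qed.
Let pow2D (x z : R) : (2 : R) `^ (x + z) = 2 `^ x * 2 `^ z.
Proof. by rewrite powRD// pnatr_eq0 implybT. Qed.

Let pow2N_lt1 (x : R) : 0 < x -> (2 : R) `^ (- x) < 1.
Proof.
move=> x0; rewrite powRN invf_lt1//.
have : (1 : R) `^ x < 2 `^ x.
  by apply: gt0_ltr_powR; rewrite ?nnegrE// ltr1n.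
by rewrite powR1.
Qed.

Let a_gt0 : 0 < a. Proof. by rewrite divr_gt0// addr_gt0. Qed.

Let rho01 : 0 < rho < 1.
Proof.
by rewrite pow2_gt0 pow2N_lt1.
Qed.

Let rhoX n : (2 : R) `^ (- lambda * n%:R) = rho ^+ n.
Proof. by rewrite powRrM powR_mulrn// ltW. Qed.

(** The radius 2^(-a k) is such that its power gamma0 equals
    2^(-(theta + lambda) k), which cancels the growth 2^(theta k) of the Hoelder
    constant and leaves rho^k. *)
Let close n k t u : (K <= n)%N -> (k <= n)%N -> mdist t u <= 2 `^ (- (a * k%:R)) ->
  `|y n t - y n u| <= H * (2 `^ (theta * (n - k)%:R) * rho ^+ k).
Proof.
move=> Kn kn tu; rewrite (le_trans (y_hoelder _ _ Kn))// ler_wpM2l//.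
have du : mdist t u `^ gamma0 <= 2 `^ (- ((theta + lambda) * k%:R)).
  have -> : - ((theta + lambda) * k%:R) = - (a * k%:R) * gamma0.
    by rewrite /a; field; rewrite gt_eqF.
  by rewrite powRrM ge0_ler_powR// ?nnegrE ?mdist_ge0// ltW.
rewrite (le_trans (ler_wpM2l (ltW (pow2_gt0 _)) du))//.
rewrite -pow2D -rhoX -pow2D natrB//.
by rewrite le_eqVlt; apply/orP; left; apply/eqP; congr powR; ring.
Qed.

Let K1 := H * 2 `^ theta + 2 * H + 1.

(** Comparison of t with a nearby point of the net, at times n and n+1.  The
    bound is relative to 1 + y n t, as no bound on y is available yet. *)
Let step n t : (K <= n)%N ->
  `|y n.+1 t - y n t| <= K1 * rho ^+ n * (1 + y n t).
Proof.
move=> Kn; have [u unet ut] := netP n t.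
have c1 := close Kn (leqnn n) ut.
have c2 := close (leqW Kn) (leqnSn n) ut.
rewrite subnn mulr0 powRr0 mul1r in c1.
rewrite subSnn mulr1 in c2.
have c3 := y_net Kn unet; rewrite rhoX in c3.
have /andP[r0 r1] := rho01.
have rn0 : 0 < rho ^+ n by rewrite exprn_gt0.
have rn1 : rho ^+ n <= 1 by rewrite exprn_ile1// ltW.
have tr : `|y n.+1 t - y n t| <= `|y n.+1 u - y n.+1 t| + `|y n.+1 u - y n u| + `|y n u - y n t|.
  rewrite (_ : y n.+1 t - y n t = - (y n.+1 u - y n.+1 t) + (y n.+1 u - y n u) + (y n u - y n t)); last by ring.
  by rewrite (le_trans (ler_normD _ _))// lerD2r (le_trans (ler_normD _ _))// normrN.
have yu : y n u <= y n t + H.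
  have : y n u - y n t <= H * rho ^+ n by rewrite (le_trans (ler_norm _)).
  have : H * rho ^+ n <= H by rewrite ler_piMr.
  lra.
have yt := y0 n t.
apply: (le_trans tr); rewrite /K1.
have c4 : rho ^+ n * (1 + y n u) <= rho ^+ n * (1 + (y n t + H)).
  by rewrite ler_pM2l// lerD2l.
apply: (@le_trans _ _ (H * 2 `^ theta * rho ^+ n + rho ^+ n * (1 + (y n t + H)) + H * rho ^+ n)).
  by rewrite !lerD// ?(le_trans c3)// -mulrA.
rewrite (_ : _ + _ = rho ^+ n * (H * 2 `^ theta + 2 * H + 1 + y n t)); last by ring.
rewrite [leRHS](_ : _ = rho ^+ n * (K1 + K1 * y n t)); last by rewrite /K1; ring.
rewrite ler_pM2l// lerD2l ler_peMl// /K1.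
by rewrite lerDr addr_ge0// mulr_ge0// ltW.
Qed.

Let K1_ge0 : 0 <= K1.
Proof. by rewrite !addr_ge0 ?mulr_ge0// ltW. Qed.

(** From time K on, 1 + y n t is multiplied at each step by at most
    1 + K1 rho^n <= exp (K1 rho^n), and the product of these factors
    converges. *)
Let uniform_bound : exists2 Bd : R, 0 <= Bd & forall n t, (K <= n)%N -> 1 + y n t <= Bd.
Proof.
have /andP[r0 r1] := rho01.
have r1' : 0 < 1 - rho by rewrite subr_gt0.
pose F n := (1 + L K) * expR (K1 * ((1 - rho ^+ n) / (1 - rho))).
have LK (t : Gamma) : 0 <= 1 + L K by rewrite addr_ge0// (le_trans (y0 K t)).
have h m t : 1 + y (K + m)%N t <= F (K + m)%N.
  elim: m => [|m ih].
    rewrite addn0 (@le_trans _ _ (1 + L K))// ?lerD2l//.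
    have q0 : 0 <= (1 - rho ^+ K) / (1 - rho).
      by apply: divr_ge0; [rewrite subr_ge0 exprn_ile1// ltW|exact: ltW].
    rewrite /F; apply: ler_peMr; first exact: LK.
    by rewrite -[X in X <= _]expR0 ler_expR mulr_ge0.
  rewrite addnS; set n := (K + m)%N in ih *.
  have := step t (leq_addr m K); rewrite -/n => /(le_trans (ler_norm _)) s1.
  have s2 : 1 + y n.+1 t <= (1 + K1 * rho ^+ n) * (1 + y n t).
    by move: s1; clear LK; lra.
  apply: (le_trans s2).
  have -> : F n.+1 = expR (K1 * rho ^+ n) * F n.
    rewrite /F [RHS]mulrCA -expRD; congr (_ * expR _).
    by rewrite exprS; field; rewrite gt_eqF.
  apply: ler_pM => //; last exact: expR_ge1Dx.
  - by rewrite addr_ge0// mulr_ge0// exprn_ge0// ltW.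
  - by rewrite addr_ge0.
exists (Num.max 0 ((1 + L K) * expR (K1 / (1 - rho)))); first by rewrite le_max lexx.
move=> n t Kn; rewrite le_max; apply/orP; right.
have := h (n - K)%N t; rewrite subnKC// => /le_trans; apply.
rewrite ler_wpM2l// ?(LK t)// ler_expR ler_wpM2l//.
apply: ler_piMl; first by rewrite invr_ge0 ltW.
by rewrite gerBl exprn_ge0// ltW.
Qed.

(** The relative increments become absolute by the uniform bound; the finitely
    many times before K are covered by the crude bounds L. *)
Lemma pathwise_increments : exists2 C : R, 0 <= C &
  forall n t, `|y n.+1 t - y n t| <= C * rho ^+ n.
Proof.
have [Bd Bd0 HBd] := uniform_bound.
have /andP[r0 r1] := rho01.
pose Lp n := `|L n| + `|L n.+1|.
have Lp0 n : 0 <= Lp n / rho ^+ n by rewrite divr_ge0 ?addr_ge0// exprn_ge0// ltW.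
have s0 : 0 <= \sum_(k < K) Lp k / rho ^+ k by rewrite sumr_ge0.
exists (K1 * Bd + \sum_(k < K) Lp k / rho ^+ k).
  by rewrite addr_ge0// mulr_ge0.
move=> n t; have rn : 0 < rho ^+ n by rewrite exprn_gt0.
have [Kn|nK] := leqP K n.
  rewrite (le_trans (step t Kn))// [leRHS]mulrDl.
  rewrite (@le_trans _ _ (K1 * Bd * rho ^+ n))//.
    rewrite mulrAC ler_pM2r// ler_wpM2l//; exact: HBd.
  by rewrite lerDl mulr_ge0// ltW.
rewrite (@le_trans _ _ (Lp n / rho ^+ n * rho ^+ n))//.
  rewrite -mulrA mulVf ?mulr1; last by rewrite gt_eqF.
  rewrite (le_trans (ler_normB _ _))// addrC !ger0_norm// lerD//.
    exact: (le_trans (yL n t) (ler_norm _)).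
  exact: (le_trans (yL n.+1 t) (ler_norm _)).
rewrite ler_pM2r// (bigD1 (Ordinal nK))//= addrCA lerDl addr_ge0//.
  by rewrite mulr_ge0.
by rewrite sumr_ge0.
Qed.

(** For the Hoelder bound, n is chosen with 2^(-a (n+1)) < d(t,u) <= 2^(-a n).
    Then y n t - y n u and the distances of y n t and y n u to their limits are
    O(rho^n), and rho^(n+1) <= d(t,u)^(lambda / a).  Points at distance more than
    2^(-a K) are covered by the boundedness of the limit. *)
Lemma pathwise_conclusion :
  unif_exp_cvg lambda y (fun t => limn (y ^~ t)) /\
  hoelder_continuous (lambda / a) (fun t => limn (y ^~ t)).
Proof.
have [C C0 HC] := pathwise_increments.
have /andP[r0 r1] := rho01.
have r1' : 0 < 1 - rho by rewrite subr_gt0.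
pose C' := C / (1 - rho).
have C'0 : 0 <= C' by rewrite divr_ge0// ltW.
have lim_le n t : `|y n t - limn (y ^~ t)| <= C' * rho ^+ n.
  exact: (geometric_increment_cvg rho01 (HC ^~ t)).
split; first by exists C' => n t; rewrite rhoX.
pose g := lambda / a.
have g0 : 0 < g by exact: divr_gt0.
pose Y t := limn (y ^~ t).
pose S := L 0%N + C'.
have YS t : `|Y t| <= S.
  rewrite -[Y t](subKr (y 0%N t)) (le_trans (ler_normB _ _))// lerD//.
    by rewrite ger0_norm.
  by have := lim_le 0%N t; rewrite expr0 mulr1.
pose dK : R := 2 `^ (- (a * K%:R)).
have dK0 : 0 < dK `^ g by apply: powR_gt0; exact: pow2_gt0.
exists ((H + 2 * C') / rho + 2 * S / dK `^ g) => t u.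
have S0 : 0 <= S := le_trans (normr_ge0 _) (YS t).
have HC0 : 0 <= H + 2 * C' by rewrite addr_ge0// mulr_ge0.
have c1 : 0 <= (H + 2 * C') / rho by apply: divr_ge0 => //; exact: ltW.
have c2 : 0 <= 2 * S / dK `^ g by apply: divr_ge0; [rewrite mulr_ge0|exact: ltW].
have [->|tu] := eqVneq t u.
  by rewrite subrr normr0 mulr_ge0 ?addr_ge0 ?powR_ge0.
have d0 : 0 < mdist t u by rewrite mdist_gt0.
have [dle|dgt] := leP (mdist t u) dK; last first.
  apply: (@le_trans _ _ (2 * S / dK `^ g * mdist t u `^ g)); last first.
    by rewrite ler_wpM2r ?powR_ge0// lerDr.
  apply: (@le_trans _ _ (2 * S)).
    rewrite (le_trans (ler_normB _ _))// -[2 * S]/(_ * S) mulr_natl mulr2n.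
    by rewrite lerD// YS.
  rewrite -mulrA ler_peMr// ?mulr_ge0// mulrC ler_pdivlMr// mul1r.
  by apply: ge0_ler_powR; rewrite ?nnegrE ?powR_ge0 ?mdist_ge0//; exact: ltW.
(* The least such n is the scale at which t and u are compared. *)
have exn : exists n, (K <= n)%N && (2 `^ (- (a * n.+1%:R)) < mdist t u).
  pose s : R := 2 `^ (- a).
  have s0 : 0 < s by exact: pow2_gt0.
  have s1 : s < 1 by exact: pow2N_lt1.
  have cs : (fun n => s ^+ n) @ \oo --> (0 : R).
    by apply: cvg_expr; rewrite ger0_norm// ltW.
  have [n1 _ Hn1] := cvgr0_norm_lt _ cs _ d0.
  exists (maxn K n1); rewrite leq_maxl/=.
  have := Hn1 (maxn K n1).+1 (leqW (leq_maxr _ _)).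
  rewrite /= ger0_norm ?exprn_ge0 ?(ltW s0)//.
  by rewrite /s -powR_mulrn ?(ltW s0)// -powRrM mulNr.
have [Kn nd] : (K <= ex_minn exn)%N /\ (2 `^ (- (a * (ex_minn exn).+1%:R)) < mdist t u).
  by case: ex_minnP => n /andP[].
have dn : mdist t u <= 2 `^ (- (a * (ex_minn exn)%:R)).
  case: ex_minnP => -[|n] /andP[Kn' nd'] nmin.
    by move: Kn' dle; rewrite leqn0 /dK => /eqP ->.
  have [KE|Kn1] := eqVneq K n.+1; first by rewrite -KE.
  rewrite leNgt; apply/negP => lt.
  have Kn2 : (K <= n)%N by rewrite -ltnS ltn_neqAle Kn1.
  by have := nmin n; rewrite Kn2 lt ltnn => /(_ isT).
move: (ex_minn exn) Kn nd dn => n Kn nd dn.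
apply: (@le_trans _ _ ((H + 2 * C') / rho * mdist t u `^ g)); last first.
  by rewrite ler_wpM2r ?powR_ge0// lerDl.
apply: (@le_trans _ _ ((H + 2 * C') * rho ^+ n)).
  have h1 := close Kn (leqnn n) dn.
  rewrite subnn mulr0 powRr0 mul1r in h1.
  have h2 := lim_le n t; have h3 := lim_le n u.
  rewrite (_ : _ - _ = - (y n t - limn (y ^~ t)) + (y n t - y n u) + (y n u - limn (y ^~ u))); last by ring.
  rewrite (le_trans (ler_normD _ _))// (@le_trans _ _ (C' * rho ^+ n + H * rho ^+ n + C' * rho ^+ n))//.
    by rewrite lerD// (le_trans (ler_normD _ _))// lerD// normrN.
  by rewrite le_eqVlt; apply/orP; left; apply/eqP; ring.
rewrite -mulrA ler_wpM2l// mulrC ler_pdivlMr// -exprSr.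
have -> : rho ^+ n.+1 = (2 `^ (- (a * n.+1%:R))) `^ g.
  rewrite -rhoX -powRrM; congr powR; rewrite /g; field.
  by rewrite gt_eqF.
by apply: ge0_ler_powR; rewrite ?nnegrE ?powR_ge0 ?mdist_ge0//; exact: ltW.
Qed.

End pathwise.

(** * Almost sure events *)

Section almost_sure_events.
Context d {Omega : measurableType d} {R : realType} (P : probability Omega R).

(** The intersection of the exceptional sets for eps = 1 / (m+1) is null. *)
Lemma ae_of_small_exceptions (Q : Omega -> Prop) :
  (forall eps : R, 0 < eps -> exists S : set Omega,
    [/\ measurable S, (P S <= eps%:E)%E & forall w, ~ S w -> Q w]) ->
  {ae P, forall w, Q w}.
Proof.
move=> H.
have H' (m : nat) : exists S : set Omega,
    [/\ measurable S, (P S <= (m.+1%:R^-1)%:E)%E & forall w, ~ S w -> Q w].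
  by apply: H; rewrite invr_gt0.
have [S HS] := choice H'.
exists (\bigcap_m S m); split.
- by apply: bigcapT_measurable => m; have [] := HS m.
- apply/eqP; rewrite eq_le measure_ge0 andbT; apply/lee_addgt0Pr => e e0.
  rewrite add0e.
  have [m me] : exists m : nat, (m.+1%:R^-1 : R) < e.
    exists (Num.truncn e^-1); rewrite invf_plt ?posrE// -truncn_lt_nat// invr_ge0 ltW//.
  have [mS PS _] := HS m.
  apply: (@le_trans _ _ (P (S m))).
    apply: le_measure; rewrite ?inE//; last exact: bigcap_inf.
    by apply: bigcapT_measurable => k; have [] := HS k.
  by apply: (le_trans PS); rewrite lee_fin ltW.
move=> w /= nQ m _; have [_ _ SQ] := HS m.
by apply: contrapT => /SQ.
Qed.

Section one_step.
Variables (B : set (set Omega)) (A A' : set Omega) (mA : measurable A) (mA' : measurable A').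
Variables (eps : R) (Z : Omega -> R).
Hypothesis PA : (0 < P A)%E.
Hypothesis BA : B A.
Hypothesis cZ : is_cond_probability (cond_proba P mA) B A' Z.
Hypothesis Zge : forall w, A w -> 1 - eps <= Z w.

(** The lower bound on Z is integrated over A, which has probability 1 for the
    conditioned measure. *)
Lemma cond_probability_escape : 0 <= eps -> (P (A `\` A') <= eps%:E)%E.
Proof.
move=> eps0; have [_ iZ _ eZ] := cZ.
set Q := cond_proba P mA in iZ eZ.
have mAA' : measurable (A `&` A') by exact: measurableI.
pose p := fine (P A); pose s := fine (P (A `&` A')).
have pE : P A = p%:E by rewrite fineK//; exact: fin_num_measure.
have sE : P (A `&` A') = s%:E by rewrite fineK//; exact: fin_num_measure.
have p0 : 0 < p by rewrite -lte_fin -pE.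
have p1 : p <= 1 by rewrite -lee_fin -pE probability_le1.
have QE U : Q U = (P (U `&` A) * (p^-1)%:E)%E.
  rewrite /Q /cond_proba/= /mnormalize/= /mrestr setTI pE.
  by rewrite eqe gt_eqF//= pE.
have QA : Q A = 1%E by rewrite QE setIid pE -EFinM divff// gt_eqF.
have h1 : ((1 - eps)%:E <= Q (A' `&` A))%E.
  rewrite -(integral_indic Q mA mA') -(eZ _ BA) -[leLHS]mule1 -QA -integral_cst//.
  apply: le_integral => //.
  - exact: finite_measure_integrable_cst.
  - exact: (integrableS measurableT).
  - by move=> w; rewrite inE lee_fin => /Zge.
have h2 : (1 - eps) * p <= s.
  move: h1; rewrite QE -setIA setIid setIC sE -EFinM lee_fin ler_pdivlMr//.
have -> : P (A `\` A') = (P A - P (A `&` A'))%E.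
  by apply: measureD => //; have := ltry p; rewrite -pE.
rewrite pE sE -EFinB lee_fin.
have : eps * p <= eps by rewrite ler_piMr.
lra.
Qed.

End one_step.

(** A point outside some Ev n has a first time of failure n, positive as Ev 0 is
    the whole space, and then belongs to Ev n.-1 but not to Ev n. *)
Lemma chain_escape (Ev : nat -> set Omega) (eps_ : nat -> R) (eps : R) :
  (forall n, measurable (Ev n)) -> Ev 0%N = setT -> (forall n, 0 <= eps_ n) ->
  (forall n, (P (Ev n `\` Ev n.+1) <= (eps_ n.+1)%:E)%E) ->
  (\sum_(1 <= n <oo) (eps_ n)%:E <= eps%:E)%E ->
  (P (~` \bigcap_n Ev n) <= eps%:E)%E.
Proof.
move=> mEv Ev0 eps0 step sum_eps; apply: le_trans sum_eps.
apply: (@le_trans _ _ (\sum_(1 <= n <oo) P (Ev n.-1 `\` Ev n))%E).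
  apply: measure_sigma_subadditive_tail.
  - by move=> n; exact: measurableD.
  - by apply: measurableC; exact: bigcapT_measurable.
  move=> w /= nEv.
  have ex : exists n, `[< ~ Ev n w >].
    apply: contrapT => h; apply: nEv => n _; apply: contrapT => nw.
    by apply: h; exists n; exact/asboolP.
  case: (ex_minnP ex) => -[|n] /asboolP nE nmin; first by case: nE; rewrite Ev0.
  exists n.+1 => //; split => //=; apply: contrapT => nw.
  by have := nmin n (asboolT nw); rewrite ltnn.
apply: lee_nneseries => [n _ _ //|[|n] _]; last exact: step.
by rewrite /= setDv measure0 lee_fin.
Qed.

Lemma borel_cantelli (F : nat -> set Omega) (K rho : R) : 0 <= rho < 1 ->
  (forall n, measurable (F n)) -> (forall n, (P (F n) <= (K * rho ^+ n)%:E)%E) ->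
  {ae P, forall w, exists n0, forall n, (n0 <= n)%N -> ~ F n w}.
Proof.
move=> /andP[r0 r1] mF PF.
have K0 : 0 <= K.
  by have := le_trans (measure_ge0 P (F 0%N)) (PF 0%N); rewrite expr0 mulr1 lee_fin.
have P0 : P (lim_sup_set F) = 0%E.
  apply: lim_sup_set_cvg0 => //.
  apply: (@le_lt_trans _ _ (\sum_(n <oo) (K * rho ^+ n)%:E)%E).
    by apply: lee_nneseries => // n _; exact: PF.
  have cvg : series (geometric K rho) @ \oo --> K / (1 - rho).
    by apply: cvg_geometric_series; rewrite ger0_norm.
  have -> : (\sum_(n <oo) (K * rho ^+ n)%:E)%E = (K / (1 - rho))%:E.
    apply/cvg_lim => //; under eq_fun do rewrite sumEFin.
    by apply: cvg_EFin => //; exact: nearW.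
  exact: ltry.
exists (lim_sup_set F); split => //.
  apply: bigcapT_measurable => n; apply: bigcup_measurable => k _; exact: mF.
move=> w /= h n _; apply: contrapT => nF; apply: h; exists n => k nk Fk.
by apply: nF; exists k.
Qed.

End almost_sure_events.

(** * Increments along the nets *)

Section net_increments.
Context d {Omega : measurableType d} {R : realType} {M : nat}.
Variables (P : probability Omega R) (B : nat -> set (set Omega)).
Variable mu : nat -> Omega -> 'rV[R]_M -> R.
Context {Gamma : choiceType}.
Variable eta : Gamma -> {measure set (borelRn R M) -> \bar R}.
Variables (alpha kappa delta lambda : R).
Hypothesis mart : martingale_measure P B mu.
Hypothesis hF : frostman_exponent eta kappa.
Hypothesis mua : {ae P, forall w, forall n x, mu n w x <= 2 `^ (alpha * n%:R)}.
Hypothesis kappa_ge0 : 0 <= kappa.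
Hypothesis delta_ge0 : 0 <= delta.
Hypothesis lambda_ge0 : 0 <= lambda.
Hypothesis lambda_small : 0 < kappa - alpha - delta - 2 * lambda.
Variables (Psi : nat -> Omega -> nat).
Hypothesis dep : forall n, dependency_degree_le P B mu eta n (Psi n).
Variables (Ev : nat -> set Omega) (CPsi : R).
Hypothesis CPsi_ge0 : 0 <= CPsi.
Hypothesis BEv : forall n, B n (Ev n).
Hypothesis EvPsi : forall n, (0 < n)%N ->
  Ev n `<=` [set w | (Psi n w)%:R <= CPsi * 2 `^ (delta * n%:R)].
Variables (net : nat -> seq Gamma) (Cnet gnet : R).
Hypothesis Cnet_ge0 : 0 <= Cnet.
Hypothesis net_size : forall n, (size (net n))%:R <= Cnet * 2 `^ (gnet * n%:R).

Let rm : random_measures B mu := mart.1.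

Let large_increment n t : set Omega :=
  [set w | 2 `^ (- lambda * n%:R) * (1 + total_mass mu eta n t w) <
           `|total_mass mu eta n.+1 t w - total_mass mu eta n t w|].

Let pow2_gt0 (x : R) : 0 < (2 : R) `^ x. Proof. exact: powR_gt0. Qed.
Let pow2D (x z : R) : (2 : R) `^ (x + z) = 2 `^ x * 2 `^ z.
Proof. by rewrite powRD// pnatr_eq0 implybT. Qed.
Let pow2X (x : R) p : ((2 : R) `^ x) ^+ p = 2 `^ (x * p%:R).
Proof. by rewrite powRrM powR_mulrn// ltW. Qed.

Let D0 := kappa - alpha - delta.

(** Delta is the product of the degree 2^(delta n), the bound 2^(alpha n) on the
    density and the mass 2^(-kappa n) of a cube; dividing by the threshold to the
    power 2 p costs 2^(2 lambda p n). *)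
Let tail_bound p : exists (K : R) (n1 : nat), 0 <= K /\ forall n t, (n1 <= n)%N ->
  measurable (large_increment n t) /\
  (P (Ev n `&` large_increment n t) <=
    (K * 2 `^ (- ((D0 - 2 * lambda) * p%:R * n%:R)))%:E)%E.
Proof.
have [C [c [N [C1 c0 muC mu_le mu_supp]]]] := density_bound rm.
have [L etaL] := frostman_box hF N.
have [CF [n0 [CF0 HCF]]] := frostman_dyadic_cube hF.
have C0 : 0 <= C := le_trans ler01 C1.
have C10 : 0 <= C + 1 by rewrite addr_ge0.
pose Kd := (CPsi + 1) * ((C + 1) * CF).
have Kd0 : 0 <= Kd by rewrite !mulr_ge0 ?addr_ge0// ltW.
pose Kq := (C + 1) * Kd + Kd ^+ 2.
have Kq0 : 0 <= Kq by rewrite addr_ge0 ?sqr_ge0// mulr_ge0// addr_ge0.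
exists ((moment_const p)%:R * Kq ^+ p), (maxn n0 1); split.
  by rewrite mulr_ge0// exprn_ge0.
move=> n t; rewrite geq_max => /andP[nn0 n_gt0].
have bY k : bounded_rv (total_mass mu eta k t).
  rewrite (funext (fun w => total_mass_box eta mu_supp k t w)).
  exact: (bounded_intersection_mass rm C1 c0 mu_le etaL (measurable_box _) (@subset_refl _ _)).
split.
  have bg : bounded_rv (fun w =>
     `|total_mass mu eta n.+1 t w - total_mass mu eta n t w| -
     2 `^ (- lambda * n%:R) * (1 + total_mass mu eta n t w)).
    apply: bounded_rvB; first by apply: bounded_rv_norm; exact: bounded_rvB.
    apply: bounded_rvM; first exact: bounded_rv_cst.
    by apply: bounded_rvD => //; exact: bounded_rv_cst.
  rewrite (_ : large_increment n t = setT `&` (fun w =>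
     `|total_mass mu eta n.+1 t w - total_mass mu eta n t w| -
     2 `^ (- lambda * n%:R) * (1 + total_mass mu eta n t w)) @^-1` `]0, +oo[%classic).
    by apply: bg.1 => //; exact: measurable_itv.
  by rewrite setTI; apply/seteqP; split => w /=; rewrite in_itv/= andbT subr_gt0.
have [E [depE degE]] := dep n t.
pose D := Num.truncn (CPsi * 2 `^ (delta * n%:R)).
have D_ge0 : 0 <= CPsi * 2 `^ (delta * n%:R) by rewrite mulr_ge0// ltW.
have EvD w : Ev n w -> (Psi n w <= D)%N.
  by move=> /(EvPsi n_gt0) /=; rewrite /D truncn_ge_nat.
pose q := CF * 2 `^ (- (kappa * n.+1%:R)).
have q0 : 0 <= q by rewrite mulr_ge0// ltW.
have a0 : 0 <= (2 : R) `^ (alpha * n%:R) by rewrite ltW.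
have mua_n : {ae P, forall w, forall x, mu n w x <= 2 `^ (alpha * n%:R)}.
  by apply: filterS mua => w /(_ n).
have := @increment_tail _ _ _ _ P B mu mart _ eta C c L N C1 c0 muC mu_le mu_supp etaL
  n t (Ev n) D (Psi n) E depE degE (BEv n) EvD _ q a0 q0 mua_n
  (HCF n.+1 (leqW nn0) t) p (2 `^ (- lambda * n%:R)) (pow2_gt0 _).
move=> /le_trans; apply; rewrite lee_fin.
set Delta := D.+1%:R * _.
have Delta_ge0 : 0 <= Delta by apply: mulr_ge0 => //; apply: mulr_ge0 => //; exact: mulr_ge0.
pose s : R := 2 `^ (- (D0 * n%:R)).
have Delta_le : Delta <= Kd * s.
  have h1 : D.+1%:R <= (CPsi + 1) * 2 `^ (delta * n%:R) :> R.
    rewrite -natr1 mulrDl mul1r lerD//; first by rewrite truncn_le.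
    by rewrite -[leLHS](powRr0 2) ler_powR ?ler1n// mulr_ge0.
  have h2 : q <= CF * 2 `^ (- (kappa * n%:R)).
    rewrite ler_pM2l// ler_powR ?ler1n// lerN2 ler_wpM2l//.
    by rewrite ler_nat.
  apply: (@le_trans _ _ ((CPsi + 1) * 2 `^ (delta * n%:R) *
     ((C + 1) * (2 `^ (alpha * n%:R) * (CF * 2 `^ (- (kappa * n%:R))))))).
    rewrite /Delta ler_pM//; first by apply: mulr_ge0 => //; exact: mulr_ge0.
    by rewrite ler_wpM2l// ler_wpM2l.
  rewrite /Kd /s (_ : - (D0 * n%:R) = delta * n%:R + (alpha * n%:R + - (kappa * n%:R))).
    by rewrite !pow2D le_eqVlt; apply/orP; left; apply/eqP; ring.
  by rewrite /D0; ring.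
have D0_ge0 : 0 <= D0 by move: lambda_ge0 lambda_small; rewrite /D0; lra.
have s0 : 0 < s by exact: pow2_gt0.
have s1 : s <= 1.
  by rewrite -[leRHS](powRr0 2) ler_powR ?ler1n// oppr_le0 mulr_ge0.
have Dq : (C + 1) * Delta + Delta ^+ 2 <= Kq * s.
  rewrite /Kq [leRHS]mulrDl lerD//.
    by rewrite -mulrA ler_wpM2l// addr_ge0.
  apply: (@le_trans _ _ ((Kd * s) ^+ 2)).
    by apply: lerXn2r; rewrite ?nnegrE// mulr_ge0// ltW.
  by rewrite exprMn ler_wpM2l ?sqr_ge0// expr2 ler_piMl// ltW.
rewrite ler_pdivrMr ?exprn_gt0// -!mulrA ler_wpM2l//.
apply: (@le_trans _ _ ((Kq * s) ^+ p)).
  by apply: lerXn2r; rewrite ?nnegrE// ?mulr_ge0 ?(ltW s0)// addr_ge0 ?sqr_ge0// mulr_ge0// addr_ge0.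
rewrite exprMn ler_wpM2l ?exprn_ge0// /s !pow2X -pow2D.
by rewrite le_eqVlt; apply/orP; left; apply/eqP; congr powR; rewrite natrM; ring.
Qed.

(** The order p of the moment is chosen so that the tail bound times the
    cardinality 2^(gnet n) of the net is O(2^-n). *)
Lemma net_increments_small : {ae P, forall w, (forall n, Ev n w) ->
  exists n0, forall n t, (n0 <= n)%N -> t \in net n ->
    `|total_mass mu eta n.+1 t w - total_mass mu eta n t w| <=
    2 `^ (- lambda * n%:R) * (1 + total_mass mu eta n t w)}.
Proof.
have [_ BO _] := rm2_filtration rm.
pose p := (Num.truncn ((`|gnet| + 1) / (D0 - 2 * lambda))).+1.
have Dl : 0 < D0 - 2 * lambda by [].
have hp : gnet + 1 <= (D0 - 2 * lambda) * p%:R.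
  apply: (@le_trans _ _ (`|gnet| + 1)); first by rewrite lerD2r ler_norm.
  rewrite [leRHS]mulrC -ler_pdivrMr// ltW// -truncn_lt_nat//.
  by apply: divr_ge0; [rewrite addr_ge0|exact: ltW].
have [K [n1 [K0 HK]]] := tail_bound p.
pose F n := if (n1 <= n)%N then
  \big[setU/set0]_(t <- net n) (Ev n `&` large_increment n t) else set0.
have mF n : measurable (F n).
  rewrite /F; case: ifPn => // nn1; apply: bigsetU_measurable => t _.
  by apply: measurableI; [exact/BO/BEv|have [] := HK n t nn1].
have PF n : (P (F n) <= (Cnet * K * (2^-1) ^+ n)%:E)%E.
  have b0 : 0 <= Cnet * K * (2^-1) ^+ n by rewrite !mulr_ge0// exprn_ge0.
  rewrite /F; case: ifPn => nn1; last by rewrite measure0 lee_fin.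
  apply: (le_trans (measure_bigsetU_le _ _ _)).
    by move=> t; apply: measurableI; [exact/BO/BEv|have [] := HK n t nn1].
  apply: (@le_trans _ _ (\sum_(t <- net n)
      (K * 2 `^ (- ((D0 - 2 * lambda) * p%:R * n%:R)))%:E)%E).
    by apply: lee_sum => t _; have [] := HK n t nn1.
  rewrite sumEFin lee_fin big_const_seq count_predT iter_addr_0 -[leLHS]mulr_natl.
  rewrite (le_trans (ler_wpM2r _ (net_size n)))//; first by rewrite mulr_ge0// ltW.
  rewrite mulrACA ler_wpM2l ?mulr_ge0// -pow2D.
  have -> : (2^-1 : R) ^+ n = 2 `^ (- n%:R) by rewrite powR_invn// exprVn.
  rewrite ler_powR ?ler1n//.
  by have := ler_wpM2r (ler0n R n) hp; rewrite mulrDl mul1r; lra.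
have half : 0 <= (2^-1 : R) < 1 by rewrite invr_ge0 ler0n invf_lt1 ?ltr1n.
have := borel_cantelli half mF PF.
apply: filterS => w [n0 Hn0] Evw; exists (maxn n0 n1) => n t.
rewrite geq_max => /andP[nn0 nn1] tnet.
rewrite leNgt; apply/negP => lt; apply: (Hn0 n nn0); rewrite /F nn1.
by rewrite -bigcup_seq; exists t.
Qed.

End net_increments.

(** * Convergence and regularity *)

Unset Implicit Arguments.
Set Strict Implicit.

Theorem theorem4p9 (R : realType) (M : nat)
    (d : measure_display) (Omega : measurableType d) (P : probability Omega R)
    (B : nat -> set (set Omega)) (mu : nat -> Omega -> 'rV[R]_M -> R)
    (Gamma : metricType R)
    (eta : Gamma -> {measure set (borelRn R M) -> \bar R})
    (alpha kappa theta gamma0 delta : R)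
    (mu_martingale : martingale_measure P B mu)
    (Gamma_tb : totally_bounded Gamma)
    (eta_lf : locally_finite_family eta)
    (delta_ge0 : 0 <= delta)
    (mu_wsd : weakly_spatially_dependent P B mu eta delta)
    (alpha_gt0 : 0 < alpha) (kappa_gt0 : 0 < kappa)
    (theta_gt0 : 0 < theta) (gamma0_gt0 : 0 < gamma0)
    (H1 : finite_upper_box_dimension Gamma)
    (H2 : frostman_exponent eta kappa)
    (H3 : {ae P, forall w, forall n x, mu n w x <= 2 `^ (alpha * n%:R)})
    (H4 : {ae P, forall w, exists K : nat,
        (ereal_sup [set z : \bar R | exists t u n,
           [/\ t != u, (K <= n)%N &
               z = (`|total_mass mu eta n t w - total_mass mu eta n u w|
                    / (2 `^ (theta * n%:R) * mdist t u `^ gamma0))%:E]]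
         < +oo)%E})
    (gap : 0 < kappa - alpha - delta) :
  exists gamma lambda : R, [/\ 0 < gamma, 0 < lambda &
    {ae P, forall w,
      unif_exp_cvg lambda (fun n t => total_mass mu eta n t w)
                          (fun t => limit_mass mu eta t w) /\
      hoelder_continuous gamma (fun t => limit_mass mu eta t w)}].
Proof.
have [rm _] := mu_martingale.
have [C [c [N [C1 c0 muC mu_le mu_supp]]]] := density_bound rm.
have [L etaL] := frostman_box H2 N.
have [Cnet [Dim Hnet]] := H1.
have [Psi [_ dep wsd]] := mu_wsd.
(* Any lambda below half of the gap would do. *)
pose lambda := (kappa - alpha - delta) / 4.
have lambda_gt0 : 0 < lambda by rewrite divr_gt0.
have lambda_small : 0 < kappa - alpha - delta - 2 * lambda.
  by move: gap; rewrite /lambda; lra.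
pose a := (theta + lambda) / gamma0.
have a_gt0 : 0 < a by rewrite divr_gt0// addr_gt0.
have net_ex n : exists s : seq Gamma, (size s)%:R <= `|Cnet| * 2 `^ ((a * Dim) * n%:R) /\
    forall u, exists2 t, t \in s & mdist t u <= 2 `^ (- (a * n%:R)).
  have r01 : 0 < (2 : R) `^ (- (a * n%:R)) <= 1.
    rewrite powR_gt0//= -[leRHS](powRr0 2) ler_powR ?ler1n// oppr_le0.
    by rewrite mulr_ge0// ltW.
  have [s size_s sP] := Hnet _ r01; exists s; split.
    rewrite (le_trans size_s)// -powRrM mulrNN (mulrAC a) ler_wpM2r ?powR_ge0//.
    exact: ler_norm.
  move=> u; have [t ts] := sP u; rewrite ballEmdist => /ltW tu.
  by exists t.
have [net net_spec] := choice net_ex.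
have net_good : {ae P, forall w, exists n0, forall n t, (n0 <= n)%N -> t \in net n ->
    `|total_mass mu eta n.+1 t w - total_mass mu eta n t w| <=
    2 `^ (- lambda * n%:R) * (1 + total_mass mu eta n t w)}.
  apply: ae_of_small_exceptions => eps eps0.
  have [CPsi [eps_ [Ev [mEv [CPsi0 [eps_0 sum_eps] [Ev0 BEv] EvPsi condEv]]]]] := wsd eps eps0.
  have [Nul [mNul PNul subNul]] := @net_increments_small _ _ _ _ P B mu Gamma eta
    alpha kappa delta lambda mu_martingale H2 H3 (ltW kappa_gt0) delta_ge0 (ltW lambda_gt0)
    lambda_small Psi dep Ev CPsi (ltW CPsi0) (fun n => (BEv n).1) EvPsi net `|Cnet|
    (a * Dim) (normr_ge0 _) (fun n => (net_spec n).1).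
  have mI : measurable (~` \bigcap_n Ev n) by apply: measurableC; exact: bigcapT_measurable.
  exists (~` (\bigcap_n Ev n) `|` Nul); split.
  - exact: measurableU.
  - have : (P (~` (\bigcap_n Ev n) `|` Nul) <= P (~` (\bigcap_n Ev n)) + P Nul)%E.
      exact: measureU2.
    rewrite PNul adde0 => /le_trans; apply.
    apply: (chain_escape mEv Ev0 (fun n => ltW (eps_0 n))); last exact: ltW.
    move=> n; have [Z cZ ZEv] := condEv n.
    exact: (cond_probability_escape (mEv n.+1) (BEv n).2 (BEv n).1 cZ ZEv (ltW (eps_0 n.+1))).
  - move=> w /not_orP[/contrapT Evw nNul].
    apply: contrapT => bad; apply: nNul; apply: subNul => /= good.
    by apply: bad; apply: good => n; exact: Evw.
exists (lambda / a), lambda; split => //; first by rewrite divr_gt0.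
apply: filterS2 net_good H4 => w [n0 Hn0] [K0 supK0].
set S := ereal_sup _ in supK0.
have [H H_ge0 HS] : exists2 H : R, 0 <= H & forall n t u, (K0 <= n)%N ->
    `|total_mass mu eta n t w - total_mass mu eta n u w| <=
    H * (2 `^ (theta * n%:R) * mdist t u `^ gamma0).
  (* The supremum is -oo when Gamma has at most one point, hence the maximum with 0. *)
  exists (Num.max 0 (fine S)); first by rewrite le_max lexx.
  move=> n t u K0n; have [->|tu] := eqVneq t u.
    by rewrite subrr normr0 mulr_ge0 ?le_max ?lexx// mulr_ge0 ?powR_ge0.
  have p0 : 0 < 2 `^ (theta * n%:R) * mdist t u `^ gamma0.
    by rewrite mulr_gt0 ?powR_gt0// mdist_gt0.
  rewrite -ler_pdivrMr// le_max; apply/orP; right.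
  have : ((`|total_mass mu eta n t w - total_mass mu eta n u w|
    / (2 `^ (theta * n%:R) * mdist t u `^ gamma0))%:E <= S)%E.
    by apply: ereal_sup_ubound => /=; exists t, u, n.
  by case: S supK0.
have y0 n t : 0 <= total_mass mu eta n t w.
  by rewrite (total_mass_box eta mu_supp); exact: (intersection_mass_ge0 rm).
have yL n t : total_mass mu eta n t w <= C ^+ n * c * L.
  rewrite (total_mass_box eta mu_supp).
  exact: (intersection_mass_le rm C1 c0 mu_le etaL (measurable_box _) (@subset_refl _ _)).
have := @pathwise_conclusion R Gamma (fun n t => total_mass mu eta n t w)
  (fun n => C ^+ n * c * L) net lambda theta gamma0 H (maxn K0 n0)
  lambda_gt0 theta_gt0 gamma0_gt0 H_ge0 y0 yL (fun n => (net_spec n).2).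
apply.
- by move=> n t u; rewrite geq_max => /andP[K0n _]; exact: HS.
- by move=> n t; rewrite geq_max => /andP[_ n0n]; exact: Hn0.
Qed.
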